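(* Let $\mathcal R$ be a class of commutative rings such that $R[s^{-1}]\in\mathcal R$ for all $R\in\mathcal R$ and $s\in R$. Let $(\mathsf E_R\subset\mathsf K_R^{\mathsf{cta}})_{R\in\mathcal R}$ be a system of classes of contraadjusted modules or complexes of contraadjusted modules such that, for every $R\in\mathcal R$, the class $\mathsf E_R$ is closed under extensions and direct summands in $\mathsf K_R^{\mathsf{cta}}$. Assume further that the system of classes $\mathsf E$ is very colocal. Let $(\mathsf A_R\subset\mathsf E_R)_{R\in\mathcal R}$ and $(\mathsf B_R\subset\mathsf E_R)_{R\in\mathcal R}$ be two systems of classes such that, for every $R\in\mathcal R$, the pair of classes $(\mathsf A_R,\mathsf B_R)$ is a hereditary complete cotorsion pair in the exact category $\mathsf E_R$. Then the following implications hold: (a) if the class $\mathsf A$ is antilocal, then the class $\mathsf B$ is colocal; (b) if the class $\mathsf B$ is very colocal, then the class $\mathsf A$ is antilocal; (c) if the class $\mathsf B$ is very colocal, then the system of classes $\mathsf A\cap\mathsf B=(\mathsf A_R\cap\mathsf B_R)_{R\in\mathcal R}$ is strongly antilocal.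
   Context: For a commutative ring $R$, $\mathsf K_R$ denotes either the abelian category $R\text{-Mod}$ of $R$-modules (for all $R$ simultaneously) or the abelian category $\mathbf C(R\text{-Mod})$ of unbounded cochain complexes of $R$-modules (for all $R$ simultaneously). For $s\in R$, $R[s^{-1}]$ is the localization of $R$ inverting $s$; the functor $M\mapsto\operatorname{Hom}_R(R[s^{-1}],M)$ is applied termwise to complexes and yields objects of $\mathsf K_{R[s^{-1}]}$. Objects of $\mathsf K_{R[s^{-1}]}$ are viewed as objects of $\mathsf K_R$ by restriction of scalars. Classes of objects (= full subcategories) are closed under isomorphisms. A system of classes $\mathsf L=(\mathsf L_R)_{R\in\mathcal R}$ is also called ''a class $\mathsf L$''. An $R$-module $C$ is contraadjusted if $\operatorname{Ext}^1_R(R[s^{-1}],C)=0$ for all $s\in R$. $\mathsf K_R^{\mathsf{cta}}\subset\mathsf K_R$ is the full subcategory of contraadjusted $R$-modules (if $\mathsf K_R=R\text{-Mod}$) or of complexes whose terms are all contraadjusted (if $\mathsf K_R=\mathbf C(R\text{-Mod})$); it is closed under extensions in $\mathsf K_R$ and carries the inherited exact structure. Conditions on a system $\mathsf L=(\mathsf L_R\subset\mathsf K_R^{\mathsf{cta}})_{R\in\mathcal R}$: - Coascent: for any $R\in\mathcal R$, $s\in R$, $M\in\mathsf L_R$, one has $\operatorname{Hom}_R(R[s^{-1}],M)\in\mathsf L_{R[s^{-1}]}$. - Codescent: if $R\in\mathcal R$, $s_1,\dots,s_d\in R$ generate the unit ideal, and $M\in\mathsf K_R^{\mathsf{cta}}$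 satisfies $\operatorname{Hom}_R(R[s_j^{-1}],M)\in\mathsf L_{R[s_j^{-1}]}$ for all $1\le j\le d$, then $M\in\mathsf L_R$. - Direct image condition: for any $R\in\mathcal R$ and $s\in R$, every object of $\mathsf L_{R[s^{-1}]}$, viewed in $\mathsf K_R$, belongs to $\mathsf L_R$. $\mathsf L$ is colocal if it satisfies coascent and codescent; very colocal if it is colocal and satisfies the direct image condition. A system $\mathsf L=(\mathsf L_R\subset\mathsf K_R)_{R\in\mathcal R}$ is antilocal if, for any $R\in\mathcal R$ and any finite collection $s_1,\dots,s_d\in R$ generating the unit ideal, an object $M\in\mathsf K_R$ belongs to $\mathsf L_R$ if and only if $M$ is a direct summand of an object $F\in\mathsf K_R$ having a finite filtration by submodules/subcomplexes $0=F_0\subset F_1\subset\dots\subset F_N=F$ such that for every $1\le i\le N$ there is $1\le j\le d$ for which $F_i/F_{i-1}$ is obtained by restriction of scalars from an object of $\mathsf L_{R[s_j^{-1}]}$. $\mathsf L$ is strongly antilocal if, for any $R\in\mathcal R$ and any finite collection $s_1,\dots,s_d\in R$ generating the unit ideal, an object $M\in\mathsf K_R$ belongs to $\mathsf L_R$ if and only if $M$ is a direct summand of an object $\bigoplus_{j=1}^dD_j$ of $\mathsf K_R$, where each $D_j$ is obtained by restriction of scalars from an object of $\mathsf L_{R[s_j^{-1}]}$. Cotorsion pairs: $\mathsf E_R$ carries the exact structure whose admissible short exact sequences are the short exact sequences of $\mathsf K_R$ with all terms in $\mathsf E_R$. In an exact category $\mathsf E$, a pair of classes $(\mathsf A,\mathsf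 B)$ is a cotorsion pair if $\mathsf B=\{X\in\mathsf E:\operatorname{Ext}^1_{\mathsf E}(A,X)=0\ \forall A\in\mathsf A\}$ and $\mathsf A=\{Y\in\mathsf E:\operatorname{Ext}^1_{\mathsf E}(Y,B)=0\ \forall B\in\mathsf B\}$. It is complete if for every $E\in\mathsf E$ there are admissible short exact sequences $0\to B'\to A\to E\to0$ and $0\to E\to B\to A'\to0$ with $A,A'\in\mathsf A$ and $B,B'\in\mathsf B$. A complete cotorsion pair is hereditary if $\mathsf A$ is closed under kernels of admissible epimorphisms in $\mathsf E$ (equivalently, $\mathsf B$ is closed under cokernels of admissible monomorphisms; equivalently, $\operatorname{Ext}^n_{\mathsf E}(A,B)=0$ for all $A\in\mathsf A$, $B\in\mathsf B$, $n\ge1$). *)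

(* Defs.v *)
From HB Require Import structures.
From mathcomp Require Import all_boot all_order all_algebra.
From mathcomp Require Import generic_quotient ring.
From mathcomp Require Import boolp.

Set Implicit Arguments.
Unset Strict Implicit.
Unset Printing Implicit Defensive.

Import GRing.Theory.
Local Open Scope ring_scope.
Local Open Scope quotient_scope.

(* The library localizes only integral domains, and R[s^-1] may be the zero   *)
(* ring, hence comPzRingType throughout.  The pair (a, n) stands for a / s^n. *)
Module Localization.
Section Localization.
Variables (R : comPzRingType) (s : R).

Definition equiv (x y : R * nat) : bool :=
  `[< exists k, s ^+ k * (x.1 * s ^+ y.2) = s ^+ k * (y.1 * s ^+ x.2) >].

Lemma equiv_refl : reflexive equiv.
Proof. by move=> x; apply/asboolP; exists 0%N. Qed.

Lemma equiv_sym : symmetric equiv.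
Proof. by move=> x y; apply/asboolP/asboolP => -[k e]; exists k. Qed.

Lemma equiv_trans : transitive equiv.
Proof.
move=> [b m] [a n] [c p] /asboolP[/= k e] /asboolP[/= l f].
apply/asboolP; exists (k + l + m)%N => /=; rewrite !exprD.
transitivity (s ^+ l * s ^+ p * (s ^+ k * (a * s ^+ m))); first by ring.
rewrite e; transitivity (s ^+ k * s ^+ n * (s ^+ l * (b * s ^+ p))); first by ring.
by rewrite f; ring.
Qed.

Canonical equiv_equiv := EquivRel equiv equiv_refl equiv_sym equiv_trans.

Definition type := {eq_quot equiv}.
HB.instance Definition _ : EqQuotient _ equiv type := EqQuotient.on type.
HB.instance Definition _ := Choice.on type.

Definition frac (a : R) (n : nat) : type := \pi_type (a, n).

Lemma fracP a n b m :
  (exists k, s ^+ k * (a * s ^+ m) = s ^+ k * (b * s ^+ n)) <->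
  frac a n = frac b m.
Proof.
by split=> [e|/eqmodP/asboolP//]; apply/eqmodP/asboolP.
Qed.

Lemma fracW (P : type -> Prop) : (forall a n, P (frac a n)) -> forall x, P x.
Proof. by move=> Pf; elim/quotW => -[a n]; apply: Pf. Qed.

Lemma repr_frac a n :
  exists k, s ^+ k * ((repr (frac a n)).1 * s ^+ n) =
            s ^+ k * (a * s ^+ (repr (frac a n)).2).
Proof. by apply/fracP; rewrite /frac -surjective_pairing reprK. Qed.

Definition add (x y : type) : type :=
  frac ((repr x).1 * s ^+ (repr y).2 + (repr y).1 * s ^+ (repr x).2)
       ((repr x).2 + (repr y).2).
Definition opp (x : type) : type := frac (- (repr x).1) (repr x).2.
Definition mul (x y : type) : type :=
  frac ((repr x).1 * (repr y).1) ((repr x).2 + (repr y).2).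

Lemma addE a n b m :
  add (frac a n) (frac b m) = frac (a * s ^+ m + b * s ^+ n) (n + m).
Proof.
apply/fracP.
have [k e] := repr_frac a n; have [l f] := repr_frac b m.
move: (repr _) e (repr _) f => [a' n'] /= e [b' m'] /= f.
exists (k + l)%N; rewrite !exprD.
transitivity (s ^+ l * s ^+ m' * s ^+ m * (s ^+ k * (a' * s ^+ n)) +
              s ^+ k * s ^+ n' * s ^+ n * (s ^+ l * (b' * s ^+ m))); first by ring.
by rewrite e f; ring.
Qed.

Lemma oppE a n : opp (frac a n) = frac (- a) n.
Proof.
apply/fracP; have [k e] := repr_frac a n; exists k.
by rewrite !mulNr !mulrN e.
Qed.

Lemma mulE a n b m : mul (frac a n) (frac b m) = frac (a * b) (n + m).
Proof.
apply/fracP.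
have [k e] := repr_frac a n; have [l f] := repr_frac b m.
move: (repr _) e (repr _) f => [a' n'] /= e [b' m'] /= f.
exists (k + l)%N; rewrite !exprD.
transitivity ((s ^+ k * (a' * s ^+ n)) * (s ^+ l * (b' * s ^+ m))); first by ring.
by rewrite e f; ring.
Qed.

Lemma addA : associative add.
Proof.
elim/fracW=> a n; elim/fracW=> b m; elim/fracW=> c p; rewrite !addE.
by apply/fracP; exists 0%N; rewrite !exprD; ring.
Qed.

Lemma addC : commutative add.
Proof.
elim/fracW=> a n; elim/fracW=> b m; rewrite !addE.
by apply/fracP; exists 0%N; rewrite !exprD; ring.
Qed.

Lemma add0 : left_id (frac 0 0) add.
Proof.
by elim/fracW=> a n; rewrite addE; apply/fracP; exists 0%N; rewrite !exprD; ring.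
Qed.

Lemma addN : left_inverse (frac 0 0) opp add.
Proof.
by elim/fracW=> a n; rewrite oppE addE; apply/fracP; exists 0%N; rewrite !exprD; ring.
Qed.

HB.instance Definition _ := GRing.isZmodule.Build type addA addC add0 addN.

Lemma mulA : associative mul.
Proof.
elim/fracW=> a n; elim/fracW=> b m; elim/fracW=> c p; rewrite !mulE.
by apply/fracP; exists 0%N; rewrite !exprD; ring.
Qed.

Lemma mulC : commutative mul.
Proof.
elim/fracW=> a n; elim/fracW=> b m; rewrite !mulE.
by apply/fracP; exists 0%N; rewrite !exprD; ring.
Qed.

Lemma mul1 : left_id (frac 1 0) mul.
Proof.
by elim/fracW=> a n; rewrite mulE; apply/fracP; exists 0%N; rewrite !exprD; ring.
Qed.

Lemma mulDl : left_distributive mul add.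
Proof.
elim/fracW=> a n; elim/fracW=> b m; elim/fracW=> c p; rewrite !(addE, mulE).
by apply/fracP; exists 0%N; rewrite !exprD; ring.
Qed.

HB.instance Definition _ :=
  GRing.Zmodule_isComPzRing.Build type mulA mulC mul1 mulDl.

Definition inj (a : R) : type := frac a 0.

Lemma inj_is_zmod_morphism : zmod_morphism inj.
Proof.
move=> a b; rewrite -[RHS]/(add (frac a 0) (opp (frac b 0))) oppE addE.
by apply/fracP; exists 0%N; rewrite !exprD; ring.
Qed.

Lemma inj_is_monoid_morphism : monoid_morphism inj.
Proof.
by split=> // a b; rewrite -[RHS]/(mul (frac a 0) (frac b 0)) mulE.
Qed.

HB.instance Definition _ := GRing.isZmodMorphism.Build R type inj
  inj_is_zmod_morphism.
HB.instance Definition _ := GRing.isMonoidMorphism.Build R type inj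
  inj_is_monoid_morphism.

End Localization.
End Localization.
HB.export Localization.

Definition localization (R : comPzRingType) (s : R) : comPzRingType :=
  Localization.type s.

Definition toloc (R : comPzRingType) (s : R) : {rmorphism R -> localization s} :=
  @Localization.inj R s.

Lemma toloc_inverts (R : comPzRingType) (s : R) :
  exists t : localization s, toloc s s * t = 1.
Proof.
exists (Localization.frac s 1 1).
rewrite -[LHS]/(Localization.mul (Localization.frac s s 0) _) Localization.mulE.
by apply/Localization.fracP; exists 0%N; rewrite !exprD; ring.
Qed.

Definition restr (R S : comPzRingType) (phi : {rmorphism R -> S})
  (N : lmodType S) : Type := N.

Section ChangeOfRings.
Variables (R S : comPzRingType) (phi : {rmorphism R -> S}).
Local Notation restr := (restr phi).

Section Restr.
Variable N : lmodType S.
HB.instance Definition _ := GRing.Zmodule.on (restr N).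

Definition restr_scale (a : R) (x : restr N) : restr N := phi a *: (x : N).

Fact restr_scaleA a b x :
  restr_scale a (restr_scale b x) = restr_scale (a * b) x.
Proof. by rewrite /restr_scale scalerA rmorphM. Qed.
Fact restr_scale1 : left_id 1 restr_scale.
Proof. by move=> x; rewrite /restr_scale rmorph1 scale1r. Qed.
Fact restr_scaleDr : right_distributive restr_scale +%R.
Proof. by move=> a x y; rewrite /restr_scale scalerDr. Qed.
Fact restr_scaleDl x : {morph restr_scale^~ x : a b / a + b}.
Proof. by move=> a b; rewrite /restr_scale rmorphD scalerDl. Qed.

HB.instance Definition _ := GRing.Zmodule_isLmodule.Build R (restr N)
  restr_scaleA restr_scale1 restr_scaleDr restr_scaleDl.
End Restr.

Section RestrMap.
Variables (N N' : lmodType S) (f : {linear N -> N'}).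

Definition restr_map (x : restr N) : restr N' := f x.

Fact restr_map_linear : linear restr_map.
Proof. by move=> a x y; have := linearP f (phi a) x y. Qed.
HB.instance Definition _ := GRing.isLinear.Build R (restr N) (restr N') _
  restr_map restr_map_linear.
End RestrMap.

(* Hom_R(S, M), on which S acts by (a f)(x) = f (a x). *)
Definition coind (M : lmodType R) : Type := {linear restr S^o -> M}.

Lemma coind_ext (M : lmodType R) (f g : coind M) :
  (f : restr S^o -> M) =1 g -> f = g.
Proof.
case: f g => [f [[fD] [fZ]]] [g [[gD] [gZ]]] /= /funext e; subst g.
by rewrite (Prop_irrelevance fD gD) (Prop_irrelevance fZ gZ).
Qed.

Section Coind.
Variable M : lmodType R.
Implicit Types (f g h : coind M) (a b : S).

HB.instance Definition _ := gen_eqMixin (coind M).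
HB.instance Definition _ := gen_choiceMixin (coind M).

Definition coind_add f g : coind M := f \+ g.
Definition coind_zero : coind M := \0.
Definition coind_opp f : coind M := \- f.

Fact coind_addA : associative coind_add.
Proof. by move=> f g h; apply: coind_ext => x /=; rewrite addrA. Qed.
Fact coind_addC : commutative coind_add.
Proof. by move=> f g; apply: coind_ext => x /=; rewrite addrC. Qed.
Fact coind_add0 : left_id coind_zero coind_add.
Proof. by move=> f; apply: coind_ext => x /=; rewrite add0r. Qed.
Fact coind_addN : left_inverse coind_zero coind_opp coind_add.
Proof. by move=> f; apply: coind_ext => x /=; rewrite addNr. Qed.

HB.instance Definition _ := GRing.isZmodule.Build (coind M)
  coind_addA coind_addC coind_add0 coind_addN.

Definition coind_scale_fun a f (x : restr S^o) : M := f (a * (x : S)).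

Fact coind_scale_linear a f : linear (coind_scale_fun a f).
Proof.
move=> r x y; rewrite /coind_scale_fun -linearP; congr (f _).
by rewrite mulrDr; congr (_ + _); exact: mulrCA.
Qed.
HB.instance Definition _ a f := GRing.isLinear.Build R (restr S^o) M _
  (coind_scale_fun a f) (coind_scale_linear a f).

Definition coind_scale a f : coind M := coind_scale_fun a f.

Fact coind_scaleA a b f : coind_scale a (coind_scale b f) = coind_scale (a * b) f.
Proof.
by apply: coind_ext => x /=; rewrite /coind_scale_fun /= /coind_scale_fun mulrCA mulrA.
Qed.
Fact coind_scale1 : left_id 1 coind_scale.
Proof. by move=> f; apply: coind_ext => x /=; rewrite /coind_scale_fun mul1r. Qed.
Fact coind_scaleDr : right_distributive coind_scale +%R.
Proof. by move=> a f g; apply: coind_ext. Qed.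
Fact coind_scaleDl f : {morph coind_scale^~ f : a b / a + b}.
Proof.
move=> a b; apply: coind_ext => x /=; rewrite /coind_scale_fun mulrDl.
exact: raddfD.
Qed.

HB.instance Definition _ := GRing.Zmodule_isLmodule.Build S (coind M)
  coind_scaleA coind_scale1 coind_scaleDr coind_scaleDl.
End Coind.

Section CoindMap.
Variables (M M' : lmodType R) (u : {linear M -> M'}).

Definition coind_map (f : coind M) : coind M' := u \o f.

Fact coind_map_linear : linear coind_map.
Proof. by move=> a f g; apply: coind_ext => x /=; rewrite raddfD. Qed.
HB.instance Definition _ := GRing.isLinear.Build S (coind M) (coind M') _
  coind_map coind_map_linear.
End CoindMap.
Arguments coind_map {M M'} u f.
End ChangeOfRings.
Arguments restr_map {R S} phi {N N'} f x.
Arguments coind_map {R S} phi {M M'} u f.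

Record cochain_complex (R : comPzRingType) := CochainComplex {
  cterm :> int -> lmodType R;
  cdiff : forall n, {linear cterm n -> cterm (n + 1)};
  cdiff_sq : forall n x, cdiff (n + 1) (cdiff n x) = 0
}.
Arguments cdiff {R} c n.
Arguments cdiff_sq {R} c n x.

Record cochain_map (R : comPzRingType) (X Y : cochain_complex R) := CochainMap {
  cmap :> forall n, {linear X n -> Y n};
  cmap_diff : forall n x, cmap (n + 1) (cdiff X n x) = cdiff Y n (cmap n x)
}.

Section ComplexChangeOfRings.
Variables (R S : comPzRingType) (phi : {rmorphism R -> S}).

Definition restr_complex (X : cochain_complex S) : cochain_complex R :=
  @CochainComplex R (fun n => restr phi (X n))
    (fun n => restr_map phi (cdiff X n)) (cdiff_sq X).

Fact coind_complex_sq (X : cochain_complex R) n (f : coind phi (X n)) :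
  coind_map phi (cdiff X (n + 1)) (coind_map phi (cdiff X n) f) = 0.
Proof. by apply: coind_ext => x /=; rewrite cdiff_sq. Qed.

Definition coind_complex (X : cochain_complex R) : cochain_complex S :=
  @CochainComplex S (fun n => coind phi (X n))
    (fun n => coind_map phi (cdiff X n)) (@coind_complex_sq X).
End ComplexChangeOfRings.

(* The two ambient categories K_R = R-Mod and K_R = C(R-Mod) are treated      *)
(* uniformly: objects and morphisms have components indexed by [degree k],    *)
(* and exactness, monomorphisms, direct sums etc. are tested componentwise.   *)
Variant ambient := Modules | Complexes.

Definition degree (k : ambient) : Type :=
  match k with Modules => unit | Complexes => int end.

Definition obj (k : ambient) (R : comPzRingType) : Type :=
  match k with Modules => lmodType R | Complexes => cochain_complex R end.

Definition term {k R} : obj k R -> degree k -> lmodType R :=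
  match k with Modules => fun M _ => M | Complexes => fun X n => X n end.

Definition mor {k R} : obj k R -> obj k R -> Type :=
  match k with
  | Modules => fun M N => {linear M -> N}
  | Complexes => fun X Y => cochain_map X Y
  end.

Definition ap {k R} : forall {X Y : obj k R}, mor X Y ->
    forall n, {linear term X n -> term Y n} :=
  match k with
  | Modules => fun M N f _ => f
  | Complexes => fun X Y f n => f n
  end.

Definition restriction {k} {R : comPzRingType} (s : R) :
    obj k (localization s) -> obj k R :=
  match k with
  | Modules => fun N => restr (toloc s) N
  | Complexes => restr_complex (toloc s)
  end.

(* Hom_R(R[s^-1], X) *)
Definition hom_loc {k} {R : comPzRingType} (s : R) :
    obj k R -> obj k (localization s) :=
  match k with
  | Modules => fun M => coind (toloc s) M
  | Complexes => coind_complex (toloc s)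
  end.

Section Ambient.
Variables (k : ambient) (R : comPzRingType).
Implicit Types (X Y Z : obj k R) (C E A B : obj k R -> Prop).

Definition mono X Y (f : mor X Y) : Prop := forall n, injective (ap f n).

Definition isom X Y (f : mor X Y) : Prop := forall n, bijective (ap f n).

Definition zero_obj X : Prop := forall n (x : term X n), x = 0.

Definition short_exact X Y Z (f : mor X Y) (g : mor Y Z) : Prop :=
  forall n, [/\ injective (ap f n),
                forall y, ap g n y = 0 <-> exists x, ap f n x = y
              & forall z, exists y, ap g n y = z].

Definition direct_sum d (D : 'I_d -> obj k R) X
    (i : forall j, mor (D j) X) (p : forall j, mor X (D j)) : Prop :=
  forall n, [/\ forall j x, ap (p j) n (ap (i j) n x) = x,
                forall j l x, j != l -> ap (p l) n (ap (i j) n x) = 0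
              & forall y, \sum_j ap (i j) n (ap (p j) n y) = y].

Definition direct_sum2 X Z Y (i1 : mor X Y) (p1 : mor Y X)
    (i2 : mor Z Y) (p2 : mor Y Z) : Prop :=
  forall n, [/\ forall x, ap p1 n (ap i1 n x) = x,
                forall z, ap p2 n (ap i2 n z) = z,
                forall x, ap p2 n (ap i1 n x) = 0,
                forall z, ap p1 n (ap i2 n z) = 0
              & forall y, ap i1 n (ap p1 n y) + ap i2 n (ap p2 n y) = y].

(* X is a direct summand of Y, with a complement in the class C *)
Definition summand_in C X Y : Prop :=
  exists Z i1 p1 i2 p2, C Z /\ @direct_sum2 X Z Y i1 p1 i2 p2.

Definition summand X Y : Prop := summand_in (fun=> True) X Y.

Definition iso_closed C : Prop :=
  forall X Y (f : mor X Y), isom f -> C X -> C Y.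

Definition ext_closed_in C E : Prop :=
  forall X Y Z (f : mor X Y) (g : mor Y Z), C X -> C Y -> C Z ->
    short_exact f g -> E X -> E Z -> E Y.

Definition summand_closed_in C E : Prop :=
  forall X Y, C X -> C Y -> summand_in C X Y -> E Y -> E X.

Definition admissible E X Y Z (f : mor X Y) (g : mor Y Z) : Prop :=
  [/\ E X, E Y, E Z & short_exact f g].

(* The class of 0 -> X -> Y -> Z -> 0 in the Yoneda group Ext^1(Z, X) is zero  *)
(* iff the sequence is isomorphic, with identities at both ends, to the split *)
(* one, i.e. iff f and g are part of a direct sum diagram.                    *)
Definition split_extension X Y Z (f : mor X Y) (g : mor Y Z) : Prop :=
  exists (r : mor Y X) (t : mor Z Y), direct_sum2 f r t g.

(* Ext^1_E(Z, X) = 0 *)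
Definition Ext1_zero E (Z X : obj k R) : Prop :=
  forall Y (f : mor X Y) (g : mor Y Z), admissible E f g -> split_extension f g.

Definition cotorsion_pair E A B : Prop :=
  [/\ forall X, B X <-> E X /\ forall Z, A Z -> Ext1_zero E Z X
    & forall Z, A Z <-> E Z /\ forall X, B X -> Ext1_zero E Z X].

Definition complete_pair E A B : Prop :=
  forall X, E X ->
    (exists V U (f : mor V U) (g : mor U X),
       [/\ B V, A U & admissible E f g]) /\
    (exists V U (f : mor X V) (g : mor V U),
       [/\ B V, A U & admissible E f g]).

Definition hereditary_pair E A : Prop :=
  forall X Y Z (f : mor X Y) (g : mor Y Z),
    admissible E f g -> A Y -> A Z -> A X.

Definition hereditary_complete_cotorsion_pair E A B : Prop :=
  [/\ cotorsion_pair E A B, complete_pair E A B & hereditary_pair E A].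

(* Subobjects of F are given by monomorphisms [fil_emb i] into F; only the    *)
(* indices up to [fil_len] matter.                                            *)
Record filtration (F : obj k R) := Filtration {
  fil_len : nat;
  fil : nat -> obj k R;
  fil_emb : forall i, mor (fil i) F;
  fil_inc : forall i, mor (fil i) (fil i.+1);
  fil_emb_mono : forall i, (i <= fil_len)%N -> mono (fil_emb i);
  fil_incE : forall i, (i < fil_len)%N -> forall n x,
    ap (fil_emb i.+1) n (ap (fil_inc i) n x) = ap (fil_emb i) n x;
  fil_bottom : zero_obj (fil 0);
  fil_top : isom (fil_emb fil_len)
}.

End Ambient.

(* Ext^1_R(R[s^-1], M) = 0 *)
Definition contraadjusted (R : comPzRingType) (M : lmodType R) : Prop :=
  forall s : R, @Ext1_zero Modules R (fun=> True)
    (restr (toloc s) (localization s)^o) M.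

Definition cta {k R} (X : obj k R) : Prop := forall n, contraadjusted (term X n).

Definition unit_ideal (R : comPzRingType) d (s : 'I_d -> R) : Prop :=
  exists c : 'I_d -> R, \sum_j c j * s j = 1.

(* Only the classes [L R] with [Rcal R] are relevant. *)
Definition class_system (k : ambient) := forall R : comPzRingType, obj k R -> Prop.

Section Systems.
Variables (k : ambient) (Rcal : comPzRingType -> Prop).
Implicit Types L : class_system k.

Definition coascent L : Prop :=
  forall (R : comPzRingType) (s : R) X, Rcal R -> L R X -> L (localization s) (hom_loc s X).

Definition codescent L : Prop :=
  forall (R : comPzRingType) d (s : 'I_d -> R) (X : obj k R), Rcal R -> unit_ideal s -> cta X ->
    (forall j, L (localization (s j)) (hom_loc (s j) X)) -> L R X.

Definition direct_image L : Prop :=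
  forall (R : comPzRingType) (s : R) X, Rcal R -> L (localization s) X -> L R (restriction X).

Definition colocal L : Prop := coascent L /\ codescent L.

Definition very_colocal L : Prop := colocal L /\ direct_image L.

(* F_(i+1) / F_i is isomorphic to D iff 0 -> F_i -> F_(i+1) -> D -> 0 is exact *)
(* for some F_(i+1) -> D.                                                      *)
Definition filtered_locally L (R : comPzRingType) d (s : 'I_d -> R)
    (F : obj k R) : Prop :=
  exists phi : filtration F, forall i, (i < fil_len phi)%N ->
    exists j (D : obj k (localization (s j)))
           (q : mor (fil phi i.+1) (restriction D)),
      L (localization (s j)) D /\ short_exact (fil_inc phi i) q.

Definition antilocal L : Prop :=
  forall (R : comPzRingType) d (s : 'I_d -> R) (X : obj k R), Rcal R -> unit_ideal s ->
    L R X <-> exists F, summand X F /\ filtered_locally L s F.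

Definition strongly_antilocal L : Prop :=
  forall (R : comPzRingType) d (s : 'I_d -> R) (X : obj k R), Rcal R -> unit_ideal s ->
    L R X <->
    exists D : forall j, obj k (localization (s j)),
      (forall j, L _ (D j)) /\
      exists F i p, summand X F /\
        direct_sum (D := fun j => restriction (D j)) (X := F) i p.

End Systems.

(* Main.v *)
(* Inside K_R write G s X for Hom_R(R[s^-1], X); it is a coreflection onto the  *)
(* objects on which s acts bijectively, and these are the R[s^-1]-objects.  As *)
(* E is closed under extensions, Ext^1_E is Ext^1 in K_R, and for X cta and an *)
(* R[s^-1]-object D one has Ext^1_R(D, X) = Ext^1_(R[s^-1])(D, G s X).  This   *)
(* gives (a), and the direct image condition for A when B is very colocal.     *)
(*                                                                             *)
(* For (b) and (c): if u + v acts bijectively on a contraadjusted M, then      *)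
(* 0 -> G (u v) M -> G u M (+) G v M -> M -> 0 is exact.  Peeling the summands *)
(* off 1 = sum_j c_j s_j one at a time, every M in E (or in B) becomes a       *)
(* quotient of an extension (or sum) P of local objects from A, with kernel    *)
(* N in E (or in B).  In (c), M in A splits off P at once.  In (b), the same   *)
(* induction embeds every N in E into some V in B with V / N filtered by local *)
(* objects from A; heredity enters because such embeddings have to pass to     *)
(* cokernels.  The pushout of P along N -> V is filtered and M splits off it.  *)
Require Import Defs.
From HB Require Import structures.
From mathcomp Require Import all_boot all_order all_algebra.
From mathcomp Require Import generic_quotient ring boolp functions.

Set Implicit Arguments.
Unset Strict Implicit.
Unset Printing Implicit Defensive.

Import GRing.Theory.
Local Open Scope ring_scope.
Local Open Scope quotient_scope.

(** * Submodules and quotient modules *)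

(** The $R[s^{-1}]$-objects are the objects of $\mathsf K_R$ on which $s$ acts bijectively, and
    [G s X] is the coreflection of [X] onto them. If [X] is contraadjusted, then taking
    $\operatorname{Hom}_R(R[s^{-1}],-)$ of an extension of such an object [D] by [X] leaves it
    exact, so the vanishing of $\operatorname{Ext}^1(D,X)$ can be tested over $R[s^{-1}]$
    ([ext0_restriction], [ext0_hom_loc]). Orthogonality to an object filtered by local pieces thus
    becomes a local condition on [X], which gives (a).

    For (b) and (c) one must produce enough local objects. Writing $1=\sum_j c_js_j$ and removing
    one summand at a time, [mayer_vietoris] and [local_induction] reduce statements about all
    objects to local ones. In this way [local_cover] finds $0\to N\to P\to M\to 0$ with $P$
    assembled from local objects of $\mathsf A$ and $N$ in the same class, $\mathsf E$ or $\mathsf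
    B$, as $M$. For $M\in\mathsf A\cap\mathsf B$ the kernel lies in $\mathsf B$, the sequence
    splits, and (c) follows.

    For $M\in\mathsf A$ the kernel is only in $\mathsf E$. By [E_enveloped] it embeds into some
    $V\in\mathsf B$ with $V/N$ filtered by local objects of $\mathsf A$. The pushout $Q$ of $P$
    along $N\to V$ is an extension of $V/N$ by $P$, hence filtered, and an extension of $M$ by $V$,
    hence split; so $M$ is a summand of $Q$, which is (b). The embedding comes from the same
    induction; its delicate step is the passage to a cokernel ([enveloped_cokernel]), where heredity
    enters through [B_cokernel]. *)

Definition submodule (R : comPzRingType) (M : lmodType R) (U : M -> Prop) :=
  U 0 /\ forall a x y, U x -> U y -> U (a *: x + y).

Section Submodule.
Variables (R : comPzRingType) (M : lmodType R) (U : M -> Prop).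
Hypothesis U_submod : submodule U.

Lemma submoduleD x y : U x -> U y -> U (x + y).
Proof. by move=> Ux Uy; rewrite -[x]scale1r; apply: U_submod.2. Qed.
Lemma submoduleZ a x : U x -> U (a *: x).
Proof. by move=> Ux; rewrite -[_ *: _]addr0; apply: U_submod.2 => //; apply: U_submod.1. Qed.
Lemma submoduleN x : U x -> U (- x).
Proof. by rewrite -scaleN1r; apply: submoduleZ. Qed.
Definition submod_pred : {pred M} := fun x => `[< U x >].

Fact submod_pred_closed : GRing.submod_closed submod_pred.
Proof.
split=> [|a x y /asboolP Ux /asboolP Uy]; apply/asboolP.
  exact: U_submod.1.
exact: U_submod.2.
Qed.
HB.instance Definition _ :=
  GRing.isSubmodClosed.Build R M submod_pred submod_pred_closed.

Record submod_type := Submod { submod_val :> M; _ : submod_val \in submod_pred }.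
HB.instance Definition _ := [isSub for submod_val].
HB.instance Definition _ := [Choice of submod_type by <:].
HB.instance Definition _ := [SubChoice_isSubLmodule of submod_type by <:].

Lemma submodule_exists : exists (N : lmodType R) (i : {linear N -> M}),
  injective i /\ forall y, U y <-> exists x, i x = y.
Proof.
exists submod_type, (\val : {linear submod_type -> M}); split; first exact: val_inj.
move=> y; split=> [Uy|[[x Ux] <-]]; last exact/asboolP.
have Uy' : y \in submod_pred by apply/asboolP.
by exists (Submod Uy').
Qed.

Definition qequiv (x y : M) : bool := `[< U (x - y) >].

Lemma qequiv_refl : reflexive qequiv.
Proof. by move=> x; apply/asboolP; rewrite subrr; apply: U_submod.1. Qed.
Lemma qequiv_sym : symmetric qequiv.
Proof.
by move=> x y; apply/asboolP/asboolP=> /submoduleN; rewrite opprB.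
Qed.
Lemma qequiv_trans : transitive qequiv.
Proof.
move=> y x z /asboolP xy /asboolP yz; apply/asboolP.
by rewrite -(subrKA y); apply: submoduleD.
Qed.

Canonical qequiv_equiv := EquivRel qequiv qequiv_refl qequiv_sym qequiv_trans.
Definition quot_type := {eq_quot qequiv}.
HB.instance Definition _ : EqQuotient _ qequiv quot_type := EqQuotient.on quot_type.
HB.instance Definition _ := Choice.on quot_type.

Definition qcls (x : M) : quot_type := \pi_quot_type x.

Lemma qclsP x y : U (x - y) <-> qcls x = qcls y.
Proof.
by split=> [e|/eqmodP/asboolP//]; apply/eqmodP/asboolP.
Qed.

Lemma qclsW (P : quot_type -> Prop) : (forall x, P (qcls x)) -> forall x, P x.
Proof. by move=> Pf; elim/quotW => x; apply: Pf. Qed.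

Lemma repr_qcls x : U (repr (qcls x) - x).
Proof. by apply/qclsP; rewrite /qcls reprK. Qed.

Definition qadd (x y : quot_type) := qcls (repr x + repr y).
Definition qopp (x : quot_type) := qcls (- repr x).
Definition qscale (a : R) (x : quot_type) := qcls (a *: repr x).

Lemma qaddE x y : qadd (qcls x) (qcls y) = qcls (x + y).
Proof. by apply/qclsP; rewrite opprD addrACA; apply: submoduleD; apply: repr_qcls. Qed.
Lemma qoppE x : qopp (qcls x) = qcls (- x).
Proof. by apply/qclsP; rewrite -opprD; apply: submoduleN; apply: repr_qcls. Qed.
Lemma qscaleE a x : qscale a (qcls x) = qcls (a *: x).
Proof. by apply/qclsP; rewrite -scalerBr; apply: submoduleZ; apply: repr_qcls. Qed.

Lemma qaddA : associative qadd.
Proof. by elim/qclsW=> x; elim/qclsW=> y; elim/qclsW=> z; rewrite !qaddE addrA. Qed.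
Lemma qaddC : commutative qadd.
Proof. by elim/qclsW=> x; elim/qclsW=> y; rewrite !qaddE addrC. Qed.
Lemma qadd0 : left_id (qcls 0) qadd.
Proof. by elim/qclsW=> x; rewrite qaddE add0r. Qed.
Lemma qaddN : left_inverse (qcls 0) qopp qadd.
Proof. by elim/qclsW=> x; rewrite qoppE qaddE addNr. Qed.
HB.instance Definition _ := GRing.isZmodule.Build quot_type qaddA qaddC qadd0 qaddN.

Lemma qscaleA a b x : qscale a (qscale b x) = qscale (a * b) x.
Proof. by elim/qclsW: x => x; rewrite !qscaleE scalerA. Qed.
Lemma qscale1 : left_id 1 qscale.
Proof. by elim/qclsW=> x; rewrite qscaleE scale1r. Qed.
Lemma qscaleDr : right_distributive qscale +%R.
Proof.
move=> a; elim/qclsW=> x; elim/qclsW=> y.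
rewrite -[LHS]/(qscale a (qadd _ _)) -[RHS]/(qadd (qscale _ _) (qscale _ _)).
by rewrite !(qaddE, qscaleE) scalerDr.
Qed.
Lemma qscaleDl x : {morph qscale^~ x : a b / a + b}.
Proof.
move=> a b; elim/qclsW: x => x; rewrite -[RHS]/(qadd (qscale _ _) (qscale _ _)).
by rewrite !(qaddE, qscaleE) scalerDl.
Qed.
HB.instance Definition _ := GRing.Zmodule_isLmodule.Build R quot_type
  qscaleA qscale1 qscaleDr qscaleDl.

Fact qcls_linear : linear qcls.
Proof.
move=> a x y; rewrite -[RHS]/(qadd (qscale _ _) _).
by rewrite qscaleE qaddE.
Qed.
HB.instance Definition _ := GRing.isLinear.Build R M quot_type _ qcls qcls_linear.

Lemma quotient_exists : exists (N : lmodType R) (p : {linear M -> N}),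
  (forall z, exists y, p y = z) /\ forall y, p y = 0 <-> U y.
Proof.
exists quot_type, (qcls : {linear M -> quot_type}); split.
  by elim/qclsW=> x; exists x.
by move=> y; rewrite -[U y]/(U y) -[y in U y]subr0 qclsP (_ : qcls 0 = 0).
Qed.
End Submodule.

(** * The ambient abelian category *)

Lemma dchoice (T : Type) (U : T -> Type) (P : forall x, U x -> Prop) :
  (forall x, exists y, P x y) -> exists f : forall x, U x, forall x, P x (f x).
Proof. by move=> /(_ _)/cid-/all_sig[f fP]; exists f. Qed.

Definition mklin (R : comPzRingType) (M N : lmodType R) (g : M -> N)
  (g_lin : linear g) : {linear M -> N} :=
  HB.pack g (GRing.isLinear.Build R M N _ g g_lin).

Section LinearFactor.
Variables (R : comPzRingType) (M N W : lmodType R).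

Lemma linear_factor_mono (i : {linear N -> M}) (g : {linear W -> M}) :
  injective i -> (forall w, exists x, i x = g w) ->
  exists h : {linear W -> N}, forall w, i (h w) = g w.
Proof.
move=> i_inj /choice[h hP].
have h_lin : linear h by move=> a x y; apply: i_inj; rewrite linearP !hP linearP.
by exists (mklin h_lin).
Qed.

Lemma linear_factor_epi (p : {linear M -> N}) (g : {linear M -> W}) :
  (forall z, exists y, p y = z) -> (forall y, p y = 0 -> g y = 0) ->
  exists h : {linear N -> W}, forall y, h (p y) = g y.
Proof.
move=> /choice[q qP] g0.
have gq x y : p x = p y -> g x = g y.
  move=> e; apply/eqP; rewrite -subr_eq0 -linearB; apply/eqP/g0.
  by rewrite linearB e subrr.
have h_lin : linear (g \o q).
  by move=> a x y /=; rewrite -linearP; apply: gq; rewrite linearP !qP.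
by exists (mklin h_lin) => y /=; apply: gq; rewrite qP.
Qed.
End LinearFactor.

Definition next {k} : degree k -> degree k :=
  match k with Modules => fun n => n | Complexes => fun n => n + 1 end.

(* Modules get the zero differential, so that both ambient categories consist *)
(* of graded objects with a square-zero map and of the maps commuting with it.*)
Definition diff {k R} :
    forall (X : obj k R) n, {linear term X n -> term X (next n)} :=
  match k with
  | Modules => fun M _ => \0
  | Complexes => fun X n => cdiff X n
  end.

Definition mk {k R} : forall (X Y : obj k R) (g : forall n, {linear term X n -> term Y n}),
    (forall n x, g (next n) (diff X n x) = diff Y n (g n x)) -> mor X Y :=
  match k with
  | Modules => fun X Y g _ => g tt
  | Complexes => fun X Y g e => CochainMap e
  end.

Section Ambient.
Variables (k : ambient) (R : comPzRingType).
Implicit Types X Y Z W : obj k R.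

Lemma mkE X Y g e n x : ap (@mk k R X Y g e) n x = g n x.
Proof. by case: k X Y g e n x => //= X Y g e []. Qed.

Lemma ap_diff X Y (f : mor X Y) n x :
  ap f (next n) (diff X n x) = diff Y n (ap f n x).
Proof. by case: k X Y f n x => //= [X Y f n x|X Y f n x]; rewrite ?raddf0 ?cmap_diff. Qed.

Lemma diff_sq X n x : diff X (next n) (diff X n x) = 0.
Proof. by case: k X n x => //= X n x; rewrite cdiff_sq. Qed.

Definition idm X : mor X X :=
  mk (g := fun n => idfun : {linear term X n -> term X n}) (fun n x => erefl).

Fact comp_subproof X Y Z (g : mor Y Z) (f : mor X Y) n x :
  (ap g (next n) \o ap f (next n)) (diff X n x) = diff Z n ((ap g n \o ap f n) x).
Proof. by rewrite /= !ap_diff. Qed.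
Definition compm X Y Z (g : mor Y Z) (f : mor X Y) : mor X Z :=
  mk (g := fun n => ap g n \o ap f n : {linear _ -> _}) (@comp_subproof X Y Z g f).

Fact add_subproof X Y (g f : mor X Y) n x :
  (ap g (next n) \+ ap f (next n)) (diff X n x) = diff Y n ((ap g n \+ ap f n) x).
Proof. by rewrite /= !ap_diff raddfD. Qed.
Definition addm X Y (g f : mor X Y) : mor X Y :=
  mk (g := fun n => ap g n \+ ap f n : {linear _ -> _}) (@add_subproof X Y g f).

Fact opp_subproof X Y (f : mor X Y) n x :
  (\- ap f (next n)) (diff X n x) = diff Y n ((\- ap f n) x).
Proof. by rewrite /= !ap_diff raddfN. Qed.
Definition oppm X Y (f : mor X Y) : mor X Y :=
  mk (g := fun n => \- ap f n : {linear _ -> _}) (@opp_subproof X Y f).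

Fact zero_subproof X Y n x :
  (\0 : {linear term X (next n) -> term Y (next n)}) (diff X n x) = diff Y n 0.
Proof. by rewrite raddf0. Qed.
Definition zerom X Y : mor X Y :=
  mk (g := fun n => \0 : {linear _ -> _}) (@zero_subproof X Y).

Lemma idmE X n x : ap (idm X) n x = x. Proof. exact: mkE. Qed.
Lemma compmE X Y Z (g : mor Y Z) (f : mor X Y) n x :
  ap (compm g f) n x = ap g n (ap f n x).
Proof. exact: mkE. Qed.
Lemma addmE X Y (g f : mor X Y) n x : ap (addm g f) n x = ap g n x + ap f n x.
Proof. exact: mkE. Qed.
Lemma oppmE X Y (f : mor X Y) n x : ap (oppm f) n x = - ap f n x.
Proof. exact: mkE. Qed.
Lemma zeromE X Y n x : ap (zerom X Y) n x = 0.
Proof. exact: mkE. Qed.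

Definition morE := (idmE, compmE, addmE, oppmE, zeromE).

Definition epi X Y (p : mor X Y) := forall n z, exists y, ap p n y = z.

Lemma factor_mono K X W (i : mor K X) (g : mor W X) :
  mono i -> (forall n w, exists x, ap i n x = ap g n w) ->
  exists h : mor W K, forall n w, ap i n (ap h n w) = ap g n w.
Proof.
move=> i_inj gi.
have [h hP] := dchoice (fun n => linear_factor_mono (i_inj n) (gi n)).
have e n x : h (next n) (diff W n x) = diff K n (h n x).
  by apply: i_inj; rewrite hP !ap_diff hP.
by exists (mk e) => n w; rewrite mkE hP.
Qed.

Lemma factor_epi X Q W (p : mor X Q) (g : mor X W) :
  epi p -> (forall n y, ap p n y = 0 -> ap g n y = 0) ->
  exists h : mor Q W, forall n y, ap h n (ap p n y) = ap g n y.
Proof.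
move=> p_surj gp.
have [h hP] := dchoice (fun n => linear_factor_epi (p_surj n) (gp n)).
have e n x : h (next n) (diff Q n x) = diff W n (h n x).
  by have [y <-] := p_surj n x; rewrite -ap_diff !hP ap_diff.
by exists (mk e) => n w; rewrite mkE hP.
Qed.

Lemma isomP X Y (f : mor X Y) : mono f -> epi f -> isom f.
Proof.
move=> f_inj /= f_surj n; have [g gK] := dchoice (f_surj n).
by exists g => // x; apply: f_inj; rewrite gK.
Qed.

Lemma isom_mono X Y (f : mor X Y) : isom f -> mono f.
Proof. by move=> f_iso n; apply: bij_inj. Qed.

Lemma isom_epi X Y (f : mor X Y) : isom f -> epi f.
Proof. by move=> f_iso n y; have [g _ gK] := f_iso n; exists (g y). Qed.

Lemma isom_inv X Y (f : mor X Y) : isom f ->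
  exists g : mor Y X, [/\ isom g, forall n y, ap f n (ap g n y) = y
                        & forall n x, ap g n (ap f n x) = x].
Proof.
move=> f_iso; have f_mono := isom_mono f_iso.
have [|g gP] := factor_mono (g := idm Y) f_mono.
  by move=> n y; have [x xP] := isom_epi f_iso y; exists x; rewrite idmE.
have fg n y : ap f n (ap g n y) = y by rewrite gP idmE.
have gf n x : ap g n (ap f n x) = x by apply: f_mono; rewrite fg.
by exists g; split=> // n; exists (ap f n); [exact: fg | exact: gf].
Qed.

(** In the module case a degree is a variable of type [unit], and [T n] becomes [T tt] only after
    case analysis. Objects are therefore built from graded data up to the inverse maps [phi] and
    [psi]. *)
Lemma obj_exists (T : degree k -> lmodType R) (d : forall n, {linear T n -> T (next n)}) :
  (forall n x, d (next n) (d n x) = 0) ->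
  (k = Modules -> forall n x, d n x = 0) ->
  exists (X : obj k R) (phi : forall n, {linear T n -> term X n})
         (psi : forall n, {linear term X n -> T n}),
    [/\ forall n, cancel (phi n) (psi n), forall n, cancel (psi n) (phi n)
      & forall n x, phi (next n) (d n x) = diff X n (phi n x)].
Proof.
case: k T d => /= T d dd d0.
  exists (T tt), (unit_rect (fun n => {linear T n -> T tt}) (idfun : {linear T tt -> T tt})).
  exists (unit_rect (fun n => {linear T tt -> T n}) (idfun : {linear T tt -> T tt})).
  by split=> [[]|[]|[] x /=] //; apply: d0.
exists (CochainComplex dd), (fun n => idfun : {linear T n -> T n}).
by exists (fun n => idfun : {linear T n -> T n}).
Qed.

Lemma diff_module X : k = Modules -> forall n x, diff X n x = 0.
Proof. by case: k X. Qed.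

Lemma subobject_exists X (U : forall n, term X n -> Prop) :
  (forall n, submodule (@U n)) -> (forall n x, U n x -> U (next n) (diff X n x)) ->
  exists K (i : mor K X), mono i /\ forall n y, U n y <-> exists x, ap i n x = y.
Proof.
move=> U_sub U_diff.
have [T H] := dchoice (fun n => submodule_exists (U_sub n)).
have {H}[i H] := dchoice H.
have i_inj n : injective (i n) by case: (H n).
have iP n y : U n y <-> exists x, i n x = y by case: (H n).
have di n (w : T n) : exists x, i (next n) x = (diff X n \o i n) w.
  by apply/iP/U_diff/iP; exists w.
have [d dP] := dchoice (fun n => linear_factor_mono (i_inj (next n)) (di n)).
have [||K [phi [psi [psiK psiP phi_d]]]] := @obj_exists T d.
- by move=> n x; apply: i_inj; rewrite dP /= dP /= diff_sq raddf0.
- by move=> km n x; apply: i_inj; rewrite dP /= diff_module // raddf0.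
have e n x : (i (next n) \o psi (next n)) (diff K n x) = diff X n ((i n \o psi n) x).
  by rewrite /= -[x]psiP -phi_d !psiK dP.
exists K, (mk (g := fun n => i n \o psi n : {linear _ -> _}) e); split.
  move=> n x y; rewrite !mkE => /i_inj h.
  by rewrite -[x]psiP -[y]psiP h.
move=> n y; rewrite iP; split=> -[x <-]; first by exists (phi n x); rewrite mkE /= psiK.
by exists (psi n x); rewrite mkE.
Qed.

Lemma quotient_object_exists X (U : forall n, term X n -> Prop) :
  (forall n, submodule (@U n)) -> (forall n x, U n x -> U (next n) (diff X n x)) ->
  exists Q (p : mor X Q), epi p /\ forall n y, ap p n y = 0 <-> U n y.
Proof.
move=> U_sub U_diff.
have [T H] := dchoice (fun n => quotient_exists (U_sub n)).
have {H}[p H] := dchoice H.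
have p_surj n z : exists y, p n y = z by case: (H n).
have pP n y : p n y = 0 <-> U n y by case: (H n).
have dp n y : p n y = 0 -> (p (next n) \o diff X n) y = 0.
  by move=> /pP/U_diff/pP.
have [d dP] := dchoice (fun n => linear_factor_epi (p_surj n) (@dp n)).
have [||Q [phi [psi [psiK psiP phi_d]]]] := @obj_exists T d.
- move=> n x; have [y <-] := p_surj n x.
  by rewrite dP /= dP /= diff_sq raddf0.
- by move=> km n x; have [y <-] := p_surj n x; rewrite dP /= diff_module // raddf0.
have e n x : (phi (next n) \o p (next n)) (diff X n x) = diff Q n ((phi n \o p n) x).
  by rewrite /= -phi_d dP.
exists Q, (mk (g := fun n => phi n \o p n : {linear _ -> _}) e); split=> n y.
  by have [x px] := p_surj n (psi n y); exists x; rewrite mkE /= px psiP.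
rewrite mkE -pP /=; split=> [h|->]; last by rewrite raddf0.
by rewrite -[p n y]psiK h raddf0.
Qed.

Lemma sum2_exists X Z : exists Y i1 p1 i2 p2, @direct_sum2 k R X Z Y i1 p1 i2 p2.
Proof.
pose T n : lmodType R := (term X n * term Z n)%type.
pose df n (f : T n) : T (next n) := (diff X n f.1, diff Z n f.2).
have df_lin n : linear (@df n) by move=> a f g; congr pair; apply: linearP.
have [||Y [phi [psi [psiK psiP phi_d]]]] := @obj_exists T (fun n => mklin (@df_lin n)).
- by move=> n f; congr pair; apply: diff_sq.
- by move=> km n f; congr pair; apply: diff_module.
have i1_lin n : linear (fun x => phi n (x, 0)).
  by move=> a x y; rewrite -linearP; congr (phi n _); apply: injective_projections; rewrite /= ?scaler0 ?addr0.
have i2_lin n : linear (fun z => phi n (0, z)).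
  by move=> a x y; rewrite -linearP; congr (phi n _); apply: injective_projections; rewrite /= ?scaler0 ?addr0.
have p1_lin n : linear (fun y => (psi n y).1) by move=> a x y; rewrite linearP.
have p2_lin n : linear (fun y => (psi n y).2) by move=> a x y; rewrite linearP.
have i1_d n x : mklin (@i1_lin (next n)) (diff X n x) = diff Y n (mklin (@i1_lin n) x).
  by rewrite /= -phi_d /= /df /= raddf0.
have i2_d n x : mklin (@i2_lin (next n)) (diff Z n x) = diff Y n (mklin (@i2_lin n) x).
  by rewrite /= -phi_d /= /df /= raddf0.
have p1_d n x : mklin (@p1_lin (next n)) (diff Y n x) = diff X n (mklin (@p1_lin n) x).
  by rewrite /= -[x]psiP -phi_d !psiK.
have p2_d n x : mklin (@p2_lin (next n)) (diff Y n x) = diff Z n (mklin (@p2_lin n) x).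
  by rewrite /= -[x]psiP -phi_d !psiK.
exists Y, (mk i1_d), (mk p1_d), (mk i2_d), (mk p2_d) => n.
split=> x; rewrite !mkE /= ?psiK //.
rewrite -raddfD -[RHS]psiP; congr (phi n _); case: (psi n x) => a b.
by congr pair; rewrite /= ?addr0 ?add0r.
Qed.

Lemma zero_exists : exists X : obj k R, zero_obj X.
Proof.
have [||X _] := @obj_exists (fun=> R^o : lmodType R) (fun=> \0) => //.
have [||Z [i [i_inj iP]]] := @subobject_exists X (fun n x => x = 0).
- by split=> // a x y -> ->; rewrite scaler0 addr0.
- by move=> n x ->; rewrite raddf0.
exists Z => n x; apply: i_inj; rewrite raddf0; apply/iP; by exists x.
Qed.
End Ambient.

(** * Yoneda extensions *)

Section Homological.
Variables (k : ambient) (R : comPzRingType).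
Implicit Types X Y Z W V U : obj k R.

Lemma short_exactP X Y Z (f : mor X Y) (g : mor Y Z) :
  short_exact f g <->
  [/\ mono f, epi g, forall n x, ap g n (ap f n x) = 0
    & forall n y, ap g n y = 0 -> exists x, ap f n x = y].
Proof.
split=> [fg|[f_inj g_surj gf0 gf] n].
  split=> [n|n z|n x|n y]; have [f_inj gf g_surj] := fg n => //.
    by apply/gf; exists x.
  by move/gf.
by split=> [|y|]; [exact: f_inj | split=> [/gf|[x <-]] | exact: g_surj].
Qed.

Lemma epi_comp X Y Z (g : mor Y Z) (f : mor X Y) : epi g -> epi f -> epi (compm g f).
Proof.
move=> g_surj f_surj n z; have [y <-] := g_surj n z; have [x <-] := f_surj n y.
by exists x; rewrite compmE.
Qed.

Lemma mono_comp X Y Z (g : mor Y Z) (f : mor X Y) : mono g -> mono f -> mono (compm g f).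
Proof. by move=> g_inj f_inj n x y; rewrite !compmE => /g_inj/f_inj. Qed.

Lemma monoP X Y (f : mor X Y) : (forall n x, ap f n x = 0 -> x = 0) -> mono f.
Proof.
move=> f0 n x y e; apply/eqP; rewrite -subr_eq0; apply/eqP/(f0 n).
by rewrite linearB e subrr.
Qed.

Lemma mono0 X Y (f : mor X Y) n x : mono f -> ap f n x = 0 -> x = 0.
Proof. by move=> f_inj e; apply: f_inj; rewrite e raddf0. Qed.

Lemma kernel_exists Y Z (g : mor Y Z) : exists K (i : mor K Y),
  [/\ mono i, forall n x, ap g n (ap i n x) = 0
    & forall n y, ap g n y = 0 -> exists x, ap i n x = y].
Proof.
have [||K [i [i_inj iP]]] := @subobject_exists k R Y (fun n y => ap g n y = 0).
- by split=> [|a x y gx gy]; rewrite ?raddf0 // linearP gx gy scaler0 addr0.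
- by move=> n x gx; rewrite ap_diff gx raddf0.
exists K, i; split=> // n x; last by move/iP.
by apply/iP; exists x.
Qed.

Lemma kernel_short_exact Y Z (g : mor Y Z) : epi g ->
  exists K (i : mor K Y), short_exact i g.
Proof.
move=> g_surj; have [K [i [i_inj gi0 gi]]] := kernel_exists g.
by exists K, i; apply/short_exactP.
Qed.

Lemma cokernel_exists X Y (f : mor X Y) : exists Q (p : mor Y Q),
  epi p /\ forall n y, ap p n y = 0 <-> exists x, ap f n x = y.
Proof.
have [||Q [p [p_surj pP]]] :=
  @quotient_object_exists k R Y (fun n y => exists x, ap f n x = y).
- move=> n; split=> [|a _ _ [x <-] [y <-]]; first by exists 0; rewrite raddf0.
  by exists (a *: x + y); rewrite linearP.
- by move=> n _ [x <-]; exists (diff X n x); rewrite ap_diff.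
by exists Q, p.
Qed.

Lemma cokernel_short_exact X Y (f : mor X Y) : mono f ->
  exists Q (p : mor Y Q), short_exact f p.
Proof.
move=> f_inj; have [Q [p [p_surj pP]]] := cokernel_exists f.
by exists Q, p; split=> [|y|]; [exact: f_inj | exact: pP | exact: p_surj].
Qed.

Lemma factor_kernel X Y Z W (f : mor X Y) (g : mor Y Z) (h : mor W Y) :
  short_exact f g -> (forall n w, ap g n (ap h n w) = 0) ->
  exists h' : mor W X, forall n w, ap f n (ap h' n w) = ap h n w.
Proof.
by move=> /short_exactP[f_inj _ _ gf] gh; apply: factor_mono => // n w; apply: gf.
Qed.

Lemma factor_cokernel X Y Z W (f : mor X Y) (g : mor Y Z) (h : mor Y W) :
  short_exact f g -> (forall n x, ap h n (ap f n x) = 0) ->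
  exists h' : mor Z W, forall n y, ap h' n (ap g n y) = ap h n y.
Proof.
move=> /short_exactP[_ g_surj _ gf] hf; apply: factor_epi => // n y /gf[x <-].
exact: hf.
Qed.

Lemma split_of_section X Y Z (f : mor X Y) (g : mor Y Z) (t : mor Z Y) :
  short_exact f g -> (forall n z, ap g n (ap t n z) = z) -> split_extension f g.
Proof.
move=> fg gt; have /short_exactP[f_inj _ gf0 _] := fg.
have [|r rP] := factor_kernel (h := addm (idm Y) (oppm (compm t g))) fg.
  by move=> n y; rewrite !morE linearB gt subrr.
exists r, t => n; split=> [x|z|x|z|y] //.
- by apply: f_inj; rewrite rP !morE gf0 raddf0 subr0.
- by apply: f_inj; rewrite rP !morE gt subrr raddf0.
- by rewrite rP !morE subrK.
Qed.

Lemma split_of_retraction X Y Z (f : mor X Y) (g : mor Y Z) (r : mor Y X) :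
  short_exact f g -> (forall n x, ap r n (ap f n x) = x) -> split_extension f g.
Proof.
move=> fg rf; have /short_exactP[_ g_surj gf0 _] := fg.
have [|t tP] := factor_cokernel (h := addm (idm Y) (oppm (compm f r))) fg.
  by move=> n x; rewrite !morE rf subrr.
apply: (split_of_section (t := t)) => // n z; have [y <-] := g_surj n z.
by rewrite tP !morE linearB gf0 subr0.
Qed.

Lemma sum2_short_exact X Z Y i1 p1 i2 p2 :
  @direct_sum2 k R X Z Y i1 p1 i2 p2 -> short_exact i1 p2.
Proof.
move=> S; apply/short_exactP; split=> [n x y e|n z|n x|n y p2y];
  have [p1i1 p2i2 p2i1 p1i2 ip] := S n => //.
- by rewrite -[x]p1i1 e p1i1.
- by exists (ap i2 n z).
- by exists (ap p1 n y); rewrite -[RHS]ip p2y raddf0 addr0.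
Qed.

Lemma sum2_sym X Z Y i1 p1 i2 p2 :
  @direct_sum2 k R X Z Y i1 p1 i2 p2 -> direct_sum2 i2 p2 i1 p1.
Proof. by move=> S n; have [? ? ? ? ip] := S n; split=> // y; rewrite addrC. Qed.

Lemma pullback_exists Y W Z (g : mor Y Z) (h : mor W Z) :
  exists P (a : mor P Y) (b : mor P W),
  [/\ forall n x, ap g n (ap a n x) = ap h n (ap b n x),
      forall n x, ap a n x = 0 -> ap b n x = 0 -> x = 0,
      forall n y w, ap g n y = ap h n w -> exists x, ap a n x = y /\ ap b n x = w
    & forall V (c : mor V Y) (d : mor V W),
        (forall n v, ap g n (ap c n v) = ap h n (ap d n v)) ->
        exists u : mor V P, forall n v,
          ap a n (ap u n v) = ap c n v /\ ap b n (ap u n v) = ap d n v].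
Proof.
have [S [i1 [p1 [i2 [p2 SP]]]]] := @sum2_exists k R Y W.
have [P [j [j_inj gj0 gj]]] := kernel_exists (addm (compm g p1) (oppm (compm h p2))).
exists P, (compm p1 j), (compm p2 j); split=> [n x|n x|n y w e|V c d e].
- by apply/eqP; rewrite -subr_eq0; apply/eqP; have := gj0 n x; rewrite !morE.
- rewrite !morE => e1 e2; apply: (mono0 j_inj (n := n)); have [_ _ _ _ /(_ (ap j n x))<-] := SP n.
  by rewrite e1 e2 !raddf0 addr0.
- have [p1i1 p2i2 p2i1 p1i2 _] := SP n.
  have [|x jx] := gj n (ap i1 n y + ap i2 n w).
    by rewrite !morE !linearD !(p1i1, p2i1, p1i2, p2i2) !raddf0 add0r addr0 e subrr.
  by exists x; rewrite !morE jx !linearD !(p1i1, p2i1, p1i2, p2i2) add0r addr0.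
- have [|u uP] := factor_mono (g := addm (compm i1 c) (compm i2 d)) j_inj.
    move=> n v; have [p1i1 p2i2 p2i1 p1i2 _] := SP n; apply: gj.
    by rewrite !morE !linearD !(p1i1, p2i1, p1i2, p2i2) !raddf0 add0r addr0 e subrr.
  exists u => n v; have [p1i1 p2i2 p2i1 p1i2 _] := SP n.
  by rewrite !compmE uP !morE !linearD !(p1i1, p2i1, p1i2, p2i2) add0r addr0.
Qed.

Lemma pushout_exists X Y W (f : mor X Y) (h : mor X W) :
  exists Q (a : mor Y Q) (b : mor W Q),
  [/\ forall n x, ap a n (ap f n x) = ap b n (ap h n x),
      forall n q, exists y w, q = ap a n y + ap b n w,
      forall n y w, ap a n y = ap b n w -> exists x, ap f n x = y /\ ap h n x = w
    & forall V (c : mor Y V) (d : mor W V),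
        (forall n x, ap c n (ap f n x) = ap d n (ap h n x)) ->
        exists u : mor Q V, (forall n y, ap u n (ap a n y) = ap c n y) /\
                            (forall n w, ap u n (ap b n w) = ap d n w)].
Proof.
have [S [i1 [p1 [i2 [p2 SP]]]]] := @sum2_exists k R Y W.
have [Q [p [p_surj pP]]] := cokernel_exists (addm (compm i1 f) (oppm (compm i2 h))).
exists Q, (compm p i1), (compm p i2); split=> [n x|n q|n y w|V c d e].
- apply/eqP; rewrite -subr_eq0 !morE -linearB; apply/eqP/pP.
  by exists x; rewrite !morE.
- have [s <-] := p_surj n q; have [_ _ _ _ sE] := SP n.
  by exists (ap p1 n s), (ap p2 n s); rewrite !morE -linearD sE.
- rewrite !morE => /eqP; rewrite -subr_eq0 -linearB => /eqP/pP[x]; rewrite !morE => e.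
  have [p1i1 p2i2 p2i1 p1i2 _] := SP n.
  have := congr1 (ap p1 n) e; have := congr1 (ap p2 n) e.
  rewrite !linearB !(p1i1, p2i1, p1i2, p2i2) !sub0r !subr0 => e2 e1.
  by exists x; split=> //; apply: oppr_inj.
- have [|u uP] := factor_epi (g := addm (compm c p1) (compm d p2)) p_surj.
    move=> n s /pP[x <-]; have [p1i1 p2i2 p2i1 p1i2 _] := SP n.
    by rewrite !morE !linearB !(p1i1, p2i1, p1i2, p2i2) !raddf0 addr0 sub0r e subrr.
  exists u; split=> n y; have [p1i1 p2i2 p2i1 p1i2 _] := SP n.
    by rewrite compmE uP !morE p1i1 p2i1 raddf0 addr0.
  by rewrite compmE uP !morE p1i2 p2i2 raddf0 add0r.
Qed.

Lemma pullback_short_exact X Y Z W (f : mor X Y) (g : mor Y Z) (h : mor W Z) :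
  short_exact f g -> exists P (a : mor P Y) (b : mor P W) (f' : mor X P),
  [/\ forall n x, ap g n (ap a n x) = ap h n (ap b n x),
      forall n x, ap a n (ap f' n x) = ap f n x
    & short_exact f' b].
Proof.
move=> /short_exactP[f_inj g_surj gf0 gf].
have [P [a [b [e ab0 ab lift]]]] := pullback_exists g h.
have [|f' f'P] := lift X f (zerom X W); first by move=> n x; rewrite gf0 !morE raddf0.
exists P, a, b, f'; split=> // [n x|]; first by have [] := f'P n x.
apply/short_exactP; split=> [n x y|n w|n x|n p bp].
- by move/(congr1 (ap a n)); rewrite !(f'P _ _).1 => /f_inj.
- by have [y gy] := g_surj n (ap h n w); have [p [_ <-]] := ab n y w gy; exists p.
- by rewrite (f'P n x).2 morE.
- have [|x fx] := gf n (ap a n p); first by rewrite e bp raddf0.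
  exists x; apply/eqP; rewrite -subr_eq0; apply/eqP/(ab0 n); rewrite linearB.
    by rewrite (f'P n x).1 fx subrr.
  by rewrite (f'P n x).2 morE bp subrr.
Qed.

(** The pushout has an exact row ending in [Z] and, when [h] is mono with cokernel [V], an exact
    column ending in [V]. The envelope arguments read [Q] in both directions. *)
Lemma pushout_short_exact X Y Z W (f : mor X Y) (g : mor Y Z) (h : mor X W) :
  short_exact f g -> exists Q (a : mor Y Q) (b : mor W Q) (g' : mor Q Z),
  [/\ forall n x, ap a n (ap f n x) = ap b n (ap h n x),
      forall n y, ap g' n (ap a n y) = ap g n y,
      short_exact b g'
    & forall V (p : mor W V), short_exact h p ->
        exists p' : mor Q V, short_exact a p'].
Proof.
move=> /short_exactP[f_inj g_surj gf0 gf].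
have [Q [a [b [e gen ab desc]]]] := pushout_exists f h.
have [|g' [g'a g'b]] := desc Z g (zerom W Z); first by move=> n x; rewrite gf0 morE.
exists Q, a, b, g'; split=> //.
  apply/short_exactP; split=> [|n z|n w|n q].
  - apply: monoP => n w bw; have [|x [/(mono0 f_inj)-> <-]] := ab n 0 w.
      by rewrite bw raddf0.
    by rewrite raddf0.
  - by have [y <-] := g_surj n z; exists (ap a n y).
  - by rewrite g'b morE.
  - have [y [w ->]] := gen n q; rewrite linearD g'a g'b morE addr0 => /gf[x <-].
    by exists (ap h n x + w); rewrite linearD e.
move=> V p /short_exactP[h_inj p_surj ph0 ph].
have [|p' [p'a p'b]] := desc V (zerom Y V) p; first by move=> n x; rewrite ph0 morE.
exists p'; apply/short_exactP; split=> [|n v|n y|n q].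
- apply: monoP => n y ay; have [|x [<- /(mono0 h_inj)->]] := ab n y 0.
    by rewrite ay raddf0.
  by rewrite raddf0.
- by have [w <-] := p_surj n v; exists (ap b n w).
- by rewrite p'a morE.
- have [y [w ->]] := gen n q; rewrite linearD p'a p'b morE add0r => /ph[x <-].
  by exists (y + ap f n x); rewrite linearD e.
Qed.

(** Orthogonality in all of $\mathsf K_R$, so that diagram chases and changes of rings may leave
    $\mathsf E_R$; [ext0_E] and [E_ext0] compare it with Ext in $\mathsf E_R$. *)
Definition ext0 (Z X : obj k R) := Ext1_zero (fun=> True) Z X.

Lemma ext0_section Z X Y (f : mor X Y) (g : mor Y Z) : ext0 Z X -> short_exact f g ->
  exists t : mor Z Y, forall n z, ap g n (ap t n z) = z.
Proof.
move=> ZX fg; have [//|r [t S]] := ZX Y f g.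
by exists t => n z; have [] := S n.
Qed.

Lemma ext0_retraction Z X Y (f : mor X Y) (g : mor Y Z) : ext0 Z X -> short_exact f g ->
  exists r : mor Y X, forall n x, ap r n (ap f n x) = x.
Proof.
move=> ZX fg; have [//|r [t S]] := ZX Y f g.
by exists r => n z; have [] := S n.
Qed.

Lemma ext0_lift Z X Y W (f : mor X Y) (g : mor Y W) (h : mor Z W) :
  ext0 Z X -> short_exact f g ->
  exists t : mor Z Y, forall n z, ap g n (ap t n z) = ap h n z.
Proof.
move=> ZX fg; have [P [a [b [f' [e _ f'b]]]]] := pullback_short_exact h fg.
have [t tP] := ext0_section ZX f'b.
by exists (compm a t) => n z; rewrite compmE e tP.
Qed.

Lemma ext0_extend Z X Y W (f : mor W Y) (g : mor Y Z) (h : mor W X) :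
  ext0 Z X -> short_exact f g ->
  exists r : mor Y X, forall n w, ap r n (ap f n w) = ap h n w.
Proof.
move=> ZX fg; have [Q [a [b [g' [e _ bg' _]]]]] := pushout_short_exact h fg.
have [r rP] := ext0_retraction ZX bg'.
by exists (compm r a) => n z; rewrite compmE e rP.
Qed.

(** Lift [X1] into [Y]; the quotient of [Y] by this lift is an extension of [X2] by [W], whose
    retraction composes to one of [f]. *)
Lemma ext0_extl X1 X X2 (i : mor X1 X) (q : mor X X2) W : short_exact i q ->
  ext0 X1 W -> ext0 X2 W -> ext0 X W.
Proof.
move=> iq e1 e2 Y f g [_ _ _ fg].
have /short_exactP[i_inj q_surj qi0 qi] := iq.
have /short_exactP[f_inj g_surj gf0 gf] := fg.
have [t tP] := ext0_lift i e1 fg.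
have t_inj : mono t by apply: monoP => n x /(congr1 (ap g n)); rewrite tP raddf0 => /mono0->.
have [Q [p tp]] := cokernel_short_exact t_inj.
have /short_exactP[_ p_surj pt0 pt] := tp.
have [|h hP] := factor_cokernel (h := compm q g) tp.
  by move=> n x; rewrite compmE tP qi0.
have fh : short_exact (compm p f) h.
  apply/short_exactP; split=> [|n z|n w|n u].
  - apply: monoP => n w; rewrite compmE => /pt[x] tx.
    have x0 : x = 0 by apply: (mono0 i_inj (n := n)); rewrite -tP tx gf0.
    by apply: (mono0 f_inj (n := n)); rewrite -tx x0 raddf0.
  - have [x <-] := q_surj n z; have [y <-] := g_surj n x.
    by exists (ap p n y); rewrite hP compmE.
  - by rewrite compmE hP compmE gf0 raddf0.
  - have [y <-] := p_surj n u; rewrite hP compmE => /qi[x ix].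
    have [|w fw] := gf n (y - ap t n x); first by rewrite linearB tP ix subrr.
    by exists w; rewrite compmE fw linearB pt0 subr0.
have [r rP] := ext0_retraction e2 fh.
by apply: (split_of_retraction (r := compm r p)) => // n w; rewrite compmE -[RHS]rP compmE.
Qed.

(** Dually, extend [q] along [f] to [s : Y -> X2]; the kernel of [s] is an extension of [Z] by [X1],
    and its section is a section of [g]. *)
Lemma ext0_extr Z X1 X X2 (i : mor X1 X) (q : mor X X2) : short_exact i q ->
  ext0 Z X1 -> ext0 Z X2 -> ext0 Z X.
Proof.
move=> iq e1 e2 Y f g [_ _ _ fg].
have /short_exactP[i_inj q_surj qi0 qi] := iq.
have /short_exactP[f_inj g_surj gf0 gf] := fg.
have [s sP] := ext0_extend q e2 fg.
have [K [j [j_inj sj0 sj]]] := kernel_exists s.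
have [|f' f'P] := factor_mono (g := compm f i) j_inj.
  by move=> n x; apply: sj; rewrite compmE sP qi0.
have fj : short_exact f' (compm g j).
  apply/short_exactP; split=> [|n z|n x|n y].
  - apply: monoP => n x /(congr1 (ap j n)); rewrite f'P compmE raddf0.
    by move/(mono0 f_inj)/(mono0 i_inj).
  - have [y <-] := g_surj n z; have [x qx] := q_surj n (ap s n y).
    have [|u ju] := sj n (y - ap f n x); first by rewrite linearB sP qx subrr.
    by exists u; rewrite compmE ju linearB gf0 subr0.
  - by rewrite compmE f'P compmE gf0.
  - rewrite compmE => /gf[x fx]; have [|u iu] := qi n x; first by rewrite -sP fx sj0.
    by exists u; apply: j_inj; rewrite f'P compmE iu.
have [t tP] := ext0_section e1 fj.
by apply: (split_of_section (t := compm j t)) => // n z; rewrite compmE -[RHS]tP compmE.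
Qed.

Lemma ext0_summandl X Y W : summand X Y -> ext0 Y W -> ext0 X W.
Proof.
move=> [Z [i1 [p1 [i2 [p2 [_ S]]]]]] YW V f g [_ _ _ fg].
have [t tP] := ext0_lift p1 YW fg.
apply: (split_of_section (t := compm t i1)) => // n z.
by have [p1i1 _ _ _ _] := S n; rewrite compmE tP p1i1.
Qed.

Lemma ext0_summandr Z X Y : summand X Y -> ext0 Z Y -> ext0 Z X.
Proof.
move=> [X' [i1 [p1 [i2 [p2 [_ S]]]]]] ZY V f g [_ _ _ fg].
have [r rP] := ext0_extend i1 ZY fg.
apply: (split_of_retraction (r := compm p1 r)) => // n z.
by have [p1i1 _ _ _ _] := S n; rewrite compmE rP p1i1.
Qed.

Lemma isom_summand X Y (f : mor X Y) : isom f -> summand X Y.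
Proof.
move=> /isom_inv[g [_ fg gf]]; have [Z Z0] := zero_exists k R.
exists Z, f, g, (zerom Z Y), (zerom Y Z); split=> // n.
split=> [//|z|x|z|y]; rewrite ?zeromE ?raddf0 ?addr0 ?fg //.
by rewrite [RHS]Z0.
Qed.

Lemma ext0_zero Z X : zero_obj Z -> ext0 Z X.
Proof.
move=> Z0 Y f g [_ _ _ fg]; apply: (split_of_section (t := zerom Z Y)) => // n z.
by rewrite (Z0 n z) !raddf0.
Qed.

Lemma isom_id X : isom (idm X).
Proof. by move=> n; exists id => x; rewrite idmE. Qed.

Lemma short_exact_isomr X Y Z Z' (f : mor X Y) (g : mor Y Z) (h : mor Z Z') :
  isom h -> short_exact f g -> short_exact f (compm h g).
Proof.
move=> h_iso /short_exactP[f_inj g_surj gf0 gf]; apply/short_exactP.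
have h_inj := isom_mono h_iso; split=> // [|n x|n y].
- by apply: epi_comp => //; apply: isom_epi.
- by rewrite compmE gf0 raddf0.
- by rewrite compmE => /(mono0 h_inj)/gf.
Qed.

Lemma short_exact_isoml X X' Y Z (f : mor X Y) (g : mor Y Z) (h : mor X' X) :
  isom h -> short_exact f g -> short_exact (compm f h) g.
Proof.
move=> h_iso /short_exactP[f_inj g_surj gf0 gf]; apply/short_exactP.
have h_surj := isom_epi h_iso; split=> // [|n x|n y].
- by apply: mono_comp => //; apply: isom_mono.
- by rewrite compmE gf0.
- by move=> /gf[x <-]; have [x' <-] := h_surj n x; exists x'; rewrite compmE.
Qed.
End Homological.

(** * Modules over a localization *)

Section LocalizedModules.
Variables (R : comPzRingType) (s : R).
Local Notation S := (localization s).
Local Notation frac := (Localization.frac s).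
Local Notation restr := (restr (toloc s)).
Local Notation coind := (coind (toloc s)).

Lemma fracM a n b m : (frac a n * frac b m : S) = frac (a * b) (n + m).
Proof. exact: Localization.mulE. Qed.

Lemma frac_eq a n b m : a * s ^+ m = b * s ^+ n -> frac a n = frac b m.
Proof. by move=> e; apply/Localization.fracP; exists 0%N; rewrite e. Qed.

Lemma toloc_frac n : toloc s (s ^+ n) * frac 1 n = 1 :> S.
Proof. by rewrite [LHS]fracM -[RHS]/(frac 1 0); apply: frac_eq; ring. Qed.

Lemma frac_split a n : frac a n = toloc s a * frac 1 n :> S.
Proof. by rewrite [RHS]fracM mulr1. Qed.

Lemma toloc_frac1S n : toloc s s * frac 1 n.+1 = frac 1 n :> S.
Proof. by rewrite [LHS]fracM; apply: frac_eq; rewrite add0n exprS; ring. Qed.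

Lemma restr_scaleE (N : lmodType S) a (x : restr N) :
  a *: x = toloc s a *: (x : N) :> N.
Proof. by []. Qed.

Lemma restr_inv (N : lmodType S) : bijective (fun x : restr N => s *: x).
Proof.
have e : toloc s s * frac 1 1 = 1 :> S by rewrite -[RHS](toloc_frac 1) expr1.
exists (fun x => frac 1 1 *: (x : N)) => x; rewrite restr_scaleE scalerA; last by rewrite e scale1r.
by rewrite mulrC e; apply: scale1r.
Qed.

(** As $s^n$ acts invertibly, an $R$-linear map also commutes with $1/s^n$. *)
Lemma restr_linear_loc (N N' : lmodType S) (g : {linear restr N -> restr N'}) :
  linear (g : N -> N').
Proof.
have scaleE b (y : N) : g (toloc s b *: y) = toloc s b *: (g y : N') :> N'.
  by rewrite -[LHS]/(g (b *: (y : restr N))) linearZ.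
have fracE n (y : N) : g (frac 1 n *: y) = frac 1 n *: (g y : N') :> N'.
  have e : toloc s (s ^+ n) *: (g (frac 1 n *: y) : N') = g y.
    by rewrite -scaleE scalerA toloc_frac scale1r.
  by rewrite -e scalerA mulrC toloc_frac scale1r.
move=> a x y; elim/Localization.fracW: a => a n; rewrite frac_split -!scalerA.
have gD (u v : N) : g (u + v) = (g u : N') + g v by exact: (raddfD g u v).
by rewrite gD scaleE fracE.
Qed.

Lemma coind_frac (M : lmodType R) (f : coind M) a n :
  (f : restr S^o -> M) (frac a n) = a *: (f : restr S^o -> M) (frac 1 n).
Proof. by rewrite frac_split; rewrite -linearZ. Qed.

Lemma coind_scaleE (M : lmodType R) (f : coind M) (b x : S) :
  ((b *: f : coind M) : restr S^o -> M) x = (f : restr S^o -> M) (b * x).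
Proof. by []. Qed.

Lemma coind_fracS (M : lmodType R) (f : coind M) n :
  (f : restr S^o -> M) (frac 1 n) = s *: (f : restr S^o -> M) (frac 1 n.+1).
Proof. by rewrite -(toloc_frac1S n); rewrite -linearZ. Qed.

Lemma coind_eq0 (M : lmodType R) (f : coind M) :
  (forall n, (f : restr S^o -> M) (frac 1 n) = 0) -> f = 0.
Proof.
move=> f0; apply: coind_ext; elim/Localization.fracW=> a n.
by rewrite coind_frac f0 scaler0.
Qed.

(** $R[s^{-1}]$ is the colimit of $R\to R\to\cdots$ along multiplication by $s$, so a map out of it
    amounts to its values at the $1/s^n$. *)
Lemma coind_of_seq (M : lmodType R) (z : nat -> M) :
  (forall n, z n = s *: z n.+1) ->
  exists f : coind M, forall n, (f : restr S^o -> M) (frac 1 n) = z n.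
Proof.
move=> zS; pose h (x : restr S^o) : M := (repr (x : S)).1 *: z (repr (x : S)).2.
have zX n m : z n = s ^+ m *: z (n + m)%N.
  by elim: m => [|m IH]; rewrite ?scale1r ?addn0 // addnS exprSr -scalerA -zS.
have hE a n : h (frac a n) = a *: z n.
  rewrite /h; have [l e] := Localization.repr_frac s a n.
  (* Both sides are compared through the common term $z_{m+n+l}$. *)
  move: (repr _) e => [b m] /= e; rewrite (zX m (n + l)%N) (zX n (m + l)%N).
  rewrite !scalerA !exprD !addnA [(n + m)%N]addnC; congr (_ *: _).
  transitivity (s ^+ l * (b * s ^+ n)); first by ring.
  by rewrite e; ring.
have h_lin : linear h.
  move=> r; elim/Localization.fracW=> a n; elim/Localization.fracW=> b m.
  have -> : r *: (frac a n : restr S^o) + frac b m =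
            frac (r * a * s ^+ m + b * s ^+ n) (n + m) :> S.
    rewrite -[LHS]/(Localization.add (Localization.mul (frac r 0) (frac a n)) _).
    by rewrite Localization.mulE Localization.addE.
  rewrite !hE scalerDl -!scalerA -(zX n m) addnC -(zX m n).
  by congr (_ + _).
by exists (mklin h_lin) => n; rewrite /= hE scale1r.
Qed.

Definition evaluation (M : lmodType R) (f : restr (coind M)) : M :=
  ((f : coind M) : restr S^o -> M) (1 : S).

Fact evaluation_linear (M : lmodType R) : linear (@evaluation M).
Proof.
move=> a f g; rewrite /evaluation -[RHS]/(a *: _ + _).
congr (_ + _).
rewrite -[LHS]/(((toloc s a *: (f : coind M) : coind M) : restr S^o -> M) (1 : S)).
rewrite coind_scaleE mulr1 -[toloc s a]/(frac a 0) coind_frac; congr (_ *: _).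
Qed.
HB.instance Definition _ M := GRing.isLinear.Build R (restr (coind M)) M _
  (@evaluation M) (@evaluation_linear M).

Lemma evaluation_frac (M : lmodType R) (f : coind M) n :
  evaluation (frac 1 n *: f) = (f : restr S^o -> M) (frac 1 n).
Proof. by rewrite /evaluation coind_scaleE mulr1. Qed.

(** The preimage of $m$ is given by the sequence $s^{-n}m$. *)
Lemma evaluation_bij (M : lmodType R) : bijective (fun x : M => s *: x) ->
  bijective (@evaluation M).
Proof.
move=> s_bij; have s_inj := bij_inj s_bij.
have ev_inj : injective (@evaluation M).
  apply/raddf_inj => /= f f0; apply: coind_eq0; elim=> [|n IH]; first exact: f0.
  by apply: s_inj; rewrite -coind_fracS IH scaler0.
have ev_surj (m : M) : exists f, evaluation f = m.
  have [t _ tK] := s_bij.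
  have [|f fP] := @coind_of_seq M (fun n => iter n t m); first by move=> n; rewrite /= tK.
  by exists f; apply: (fP 0%N).
have [t tP] := choice ev_surj.
by exists t => // x; apply: ev_inj; rewrite tP.
Qed.

Lemma coind_adjunct (N : lmodType S) (M : lmodType R) (g : {linear restr N -> M}) :
  exists h : {linear N -> coind M}, forall y, evaluation (h y) = g y.
Proof.
have h1_lin (y : N) : linear (fun x : restr S^o => g ((x : S) *: y)).
  move=> a x x'; rewrite scalerDl raddfD -linearZ; congr (g _ + _).
  exact: esym (scalerA (toloc s a) (x : S) y).
pose h y : coind M := mklin (h1_lin y).
have h_lin : linear h.
  move=> a x y; apply: coind_ext => b /=.
  rewrite scalerDr raddfD -[in RHS](scalerA _ _ x); congr (g _ + _).
  by rewrite !scalerA mulrC.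
by exists (mklin h_lin) => y; rewrite /evaluation /= scale1r.
Qed.
End LocalizedModules.

(** * Contraadjusted modules *)

(** This is the vanishing of $\varprojlim^1$ of $M\leftarrow M\leftarrow\cdots$ along $s$, that is,
    of $\operatorname{Ext}^1_R(R[s^{-1}],M)$ computed by the telescope of $R[s^{-1}]$. *)
Definition solvable (R : comPzRingType) (M : lmodType R) (s : R) : Prop :=
  forall m : nat -> M, exists x : nat -> M, forall n, x n - s *: x n.+1 = m n.

Lemma subr_swap (V : zmodType) (a b c d : V) : a - c = b - d -> a - b = c - d.
Proof.
move/eqP; rewrite subr_eq => /eqP->.
by rewrite addrC addrA [- b + _]addrA addNr sub0r addrC.
Qed.

Section Contraadjusted.
Variables (R : comPzRingType) (M : lmodType R).

(** Lifts $y_n$ of $1/s^n$ satisfy $y_n=sy_{n+1}$ up to errors $m_n\in M$; subtracting a solution of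
    the system with right side $m$ makes them define a section. *)
Lemma solvable_contraadjusted : (forall s, solvable M s) -> contraadjusted M.
Proof.
move=> M_sol s Y f g [_ _ _ fg]; have /short_exactP[_ g_surj _ gf] := fg.
pose f' : {linear M -> Y} := f.
pose g' : {linear Y -> restr (toloc s) (localization s)^o} := g.
have y_ex n : exists y, g' y = Localization.frac s 1 n.
  exact: (g_surj tt (Localization.frac s 1 n)).
have [y yP] := choice y_ex.
have ym n : exists m, f' m = y n - s *: y n.+1.
  apply: (gf tt); apply/eqP; rewrite -[ap g tt _]/(g' _) linearB linearZ !yP subr_eq0.
  by apply/eqP; exact: esym (toloc_frac1S s n).
have [m mP] := choice ym; have [x xP] := M_sol s m.
have [|t tP] := @coind_of_seq R s Y (fun n => y n - f' (x n)).
  by move=> n; rewrite scalerBr; apply: subr_swap; rewrite -mP -xP linearB linearZ.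
apply: (@split_of_section Modules R M Y _ f g t fg).
move=> [] /=; elim/Localization.fracW=> a n; rewrite -[LHS]/(g' (t _)).
rewrite coind_frac linearZ tP linearB yP -[g' (f' _)]/(ap g tt (ap f tt _)).
have /short_exactP[_ _ -> _] := fg; rewrite subr0.
exact: esym (frac_split s a n).
Qed.

(* Formally w_n = \sum_(i >= n) s^(i-n) m_i solves w_n - s w_(n+1) = m_n; the   *)
(* partial sums of this series do so in the module W of germs at infinity of   *)
(* sequences in M.  Hence the w_n define a map R[s^-1] -> W / M, and a lift of *)
(* that map to W corrects the w_n by elements of M.                            *)
Lemma contraadjusted_solvable s : contraadjusted M -> solvable M s.
Proof.
move=> M_cta m.
pose U (w : nat -> M) := exists N, forall n, (N <= n)%N -> w n = 0.
have U_sub : submodule U.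
  split=> [|a x y [N Nx] [N' Ny]]; first by exists 0%N.
  exists (maxn N N') => n; rewrite geq_max => /andP[nN nN'].
  by rewrite !fctE Nx // Ny // scaler0 addr0.
have [W [p [p_surj pP]]] := quotient_exists U_sub.
have c_lin : linear (fun x : M => p (fun=> x)).
  by move=> a x y; rewrite -linearP; congr (p _); apply/funext => n.
pose c : @mor Modules R M W := mklin c_lin.
have c_inj : mono c.
  apply: monoP => n x; rewrite /c /= => /pP[N /(_ N)]; exact.
have [Q [q cq]] := @cokernel_short_exact Modules R M W c c_inj.
have /short_exactP[_ _ qc0 qc] := cq.
pose q' : {linear W -> Q} := q.
pose w n : nat -> M := fun N => \sum_(n <= i < N) s ^+ (i - n) *: m i.
have wS n : p (w n) - s *: p (w n.+1) = c (m n).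
  rewrite -linearZ -linearB; apply/eqP; rewrite -subr_eq0 /c /= -linearB; apply/eqP/pP.
  exists n.+1 => N nN; rewrite !fctE /w big_ltn // subnn scale1r scaler_sumr.
  rewrite addrAC [m n + _]addrC addrK -sumrB big_nat_cond big1 // => i.
  rewrite andbT => /andP[ni _]; rewrite scalerA -exprS.
  by rewrite subnS prednK ?subrr // subn_gt0.
have [|phi phiP] := @coind_of_seq R s Q (fun n => q' (p (w n))).
  move=> n; rewrite -linearZ; apply/eqP; rewrite -subr_eq0 -linearB wS.
  by apply/eqP; apply: (qc0 tt).
have [t tP] := @ext0_lift Modules R _ M W Q c q phi (M_cta s) cq.
pose t' : {linear restr (toloc s) (localization s)^o -> W} := t.
pose u n := t' (Localization.frac s 1 n).
have uS n : u n = s *: u n.+1 by rewrite /u -(toloc_frac1S s n) -linearZ.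
have xP n : exists x, c x = p (w n) - u n.
  apply: (qc tt); rewrite -[LHS]/(q' _) linearB -phiP.
  by rewrite -[q' (u n)]/(ap q tt (ap t tt _)) tP subrr.
have {xP}[x xP] := choice xP; exists x => n.
apply: (c_inj tt); rewrite -[LHS]/(mklin c_lin _) linearB linearZ.
rewrite -[LHS]/(c (x n) - s *: c (x n.+1)) !xP -[RHS]/(c (m n)) -wS scalerBr -uS.
by rewrite opprB addrA subrK.
Qed.
End Contraadjusted.

(** * The coreflection onto local objects *)

(** Describes the essential image of restriction from $R[s^{-1}]$ inside $\mathsf K_R$, without
    mentioning the localization. *)
Definition acts_bij {k} {R : comPzRingType} (s : R) (X : obj k R) : Prop :=
  forall n, bijective (fun x : term X n => s *: x).

(** The identity on elements; the two carriers agree only once [k] is known. *)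
Definition rs {k} {R : comPzRingType} {s : R} :
    forall {N : obj k (localization s)} n, term N n -> term (restriction N) n :=
  match k with
  | Modules => fun N n x => x
  | Complexes => fun N n x => x
  end.

Definition rmor {k} {R : comPzRingType} {s : R} :
    forall {N N' : obj k (localization s)}, mor N N' -> mor (restriction N) (restriction N') :=
  match k with
  | Modules => fun N N' h => restr_map (toloc s) h
  | Complexes => fun N N' h =>
      @CochainMap R (restriction (k := Complexes) N) (restriction (k := Complexes) N')
        (fun n => restr_map (toloc s) (h n)) (fun n x => cmap_diff h x)
  end.

Definition counit {k} {R : comPzRingType} (s : R) :
    forall X : obj k R, mor (restriction (hom_loc s X)) X :=
  match k with
  | Modules => fun M => @evaluation R s M
  | Complexes => fun X =>
      @CochainMap R (restriction (k := Complexes) (hom_loc s X)) X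
        (fun n => @evaluation R s (X n)) (fun n x => erefl)
  end.

Local Notation G s X := (restriction (hom_loc s X)).

Section Localized.
Variables (k : ambient) (R : comPzRingType) (s : R).
Implicit Types (N : obj k (localization s)) (X Y Z : obj k R).

Lemma rs_onto N n (y : term (restriction N) n) : exists x, rs x = y.
Proof. by case: k N n y => /= N n y; exists y. Qed.

Lemma rs_inj N n : injective (@rs k R s N n).
Proof. by case: k N n => /= N n x y. Qed.

Lemma rs0 N n : rs (0 : term N n) = 0.
Proof. by case: k N n. Qed.

Lemma rmorE N N' (h : mor N N') n x : ap (rmor h) n (rs x) = rs (ap h n x).
Proof. by case: k N N' h n x. Qed.

Lemma acts_bij_restriction N : acts_bij s (restriction N).
Proof. by case: k N => /= N n; apply: restr_inv. Qed.

Lemma rmor_full N N' (g : mor (restriction N) (restriction N')) :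
  exists h : mor N N', forall n x, ap (rmor h) n x = ap g n x.
Proof.
case: k N N' g => /= [N N' g|N N' g].
  by exists (mklin (restr_linear_loc g)).
exists (CochainMap (cmap := fun n => mklin (restr_linear_loc (g n))) (fun n x => cmap_diff g x)).
by [].
Qed.

Lemma adjunct N X (g : mor (restriction N) X) :
  exists h : mor N (hom_loc s X), forall n y, ap (counit s X) n (ap (rmor h) n y) = ap g n y.
Proof.
case: k N X g => /= [N M g|N X g].
  by have [h hP] := coind_adjunct g; exists h.
have [h hP] := dchoice (fun n => coind_adjunct (g n)).
(* An element all of whose multiples evaluate to zero is zero, so compatibility with the
   differentials can be checked after evaluation. *)
have ev0 n (f : coind (toloc s) (X n)) : (forall a : localization s, evaluation (a *: f) = 0) -> f = 0.
  by move=> f0; apply: coind_eq0 => m; rewrite -evaluation_frac.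
have hd (n : int) x : h (n + 1) (cdiff N n x) = cdiff (coind_complex (toloc s) X) n (h n x).
  apply/eqP; rewrite -subr_eq0; apply/eqP/ev0 => a.
  have -> : a *: (h (n + 1) (cdiff N n x) - cdiff (coind_complex (toloc s) X) n (h n x)) =
            h (n + 1) (cdiff N n (a *: x)) - cdiff (coind_complex (toloc s) X) n (h n (a *: x)).
    by rewrite scalerBr -!linearZ.
  move: (a *: x) => {}x; apply/eqP; rewrite linearB subr_eq0; apply/eqP.
  apply: (etrans (hP _ _)); apply: (etrans (cmap_diff g x)).
  by rewrite -[g n x]hP.
by exists (@CochainMap _ N (coind_complex (toloc s) X) h hd).
Qed.

(** An element $x$ of [G s X] is the sequence of images of $x/s^m$ under the counit. Quantifying
    over [y] with [s ^+ m *: y = x] expresses $x/s^m$ by scalars of $R$ alone. *)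
Lemma counit_eq0 X n (x : term (G s X) n) :
  (forall m y, s ^+ m *: y = x -> ap (counit s X) n y = 0) -> x = 0.
Proof.
case: k X n x => /= X n x x0; apply: coind_eq0 => m; rewrite -evaluation_frac;
  by apply: (x0 m); rewrite restr_scaleE scalerA toloc_frac scale1r.
Qed.

Lemma counit_seq X n (z : nat -> term X n) : (forall m, z m = s *: z m.+1) ->
  exists x : term (G s X) n, forall m y, s ^+ m *: y = x -> ap (counit s X) n y = z m.
Proof.
case: k X n z => /= X n z zS; have [f fP] := coind_of_seq zS; exists f => m y e;
  by rewrite -fP -evaluation_frac -e restr_scaleE scalerA mulrC toloc_frac scale1r.
Qed.

Lemma counit_isom X : acts_bij s X -> isom (counit s X).
Proof. by case: k X => /= X s_bij n; apply: evaluation_bij. Qed.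
End Localized.

(** * Objects on which $s$ acts bijectively, and closure properties of contraadjusted objects *)

Section LocalObjects.
Variables (k : ambient) (R : comPzRingType).
Implicit Types (X Y Z M : obj k R) (s : R).

Lemma acts_bij_div s X : acts_bij s X -> forall m n (x : term X n),
  exists y, s ^+ m *: y = x.
Proof.
move=> s_bij; elim=> [|m IH] n x; first by exists x; rewrite expr0 scale1r.
have [y <-] := IH n x; have [t _ tK] := s_bij n.
by exists (t y); rewrite exprSr -scalerA tK.
Qed.

Lemma acts_bij_eq0 s X : acts_bij s X -> forall m n (x : term X n),
  s ^+ m *: x = 0 -> x = 0.
Proof.
move=> s_bij; elim=> [|m IH] n x; first by rewrite expr0 scale1r.
rewrite exprSr -scalerA => /IH e; have := bij_inj (s_bij n); apply.
by rewrite e scaler0.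
Qed.

Lemma acts_bijP s X : (forall n (x : term X n), s *: x = 0 -> x = 0) ->
  (forall n (x : term X n), exists y, s *: y = x) -> acts_bij s X.
Proof.
move=> s0 s_surj n; have [t tP] := choice (s_surj n); exists t => // x.
by apply/eqP; rewrite -subr_eq0; apply/eqP/s0; rewrite scalerBr tP subrr.
Qed.

Lemma acts_bij_mull s t X : acts_bij (s * t) X -> acts_bij s X.
Proof.
move=> st_bij; apply: acts_bijP => n x.
  by move=> e; apply: (acts_bij_eq0 st_bij (m := 1)); rewrite expr1 mulrC -scalerA e scaler0.
have [y <-] := acts_bij_div st_bij 1 x.
by exists (t *: y); rewrite scalerA.
Qed.

Lemma acts_bij_mul s t X : acts_bij s X -> acts_bij t X -> acts_bij (s * t) X.
Proof.
move=> s_bij t_bij n; have [s' sK s'K] := s_bij n; have [t' tK t'K] := t_bij n.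
by exists (t' \o s') => x /=; rewrite -scalerA ?sK ?tK ?t'K ?s'K.
Qed.

Lemma acts_bij_G s X : acts_bij s (G s X).
Proof. exact: acts_bij_restriction. Qed.

Lemma adjunct_local s Y X (g : mor Y X) : acts_bij s Y ->
  exists h : mor Y (G s X), forall n y, ap (counit s X) n (ap h n y) = ap g n y.
Proof.
move=> /counit_isom/isom_inv[j [_ cj _]].
have [h hP] := adjunct (compm g (counit s Y)).
by exists (compm (rmor h) j) => n y; rewrite compmE hP compmE cj.
Qed.

(** Uniqueness in the coreflection: elements of [Y] can be divided by $s^m$, and the counit at these
    quotients determines an element of [G s X]. *)
Lemma counit_inj s Y X (h h' : mor Y (G s X)) : acts_bij s Y ->
  (forall n y, ap (counit s X) n (ap h n y) = ap (counit s X) n (ap h' n y)) ->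
  forall n y, ap h n y = ap h' n y.
Proof.
move=> s_bij e n y; apply/eqP; rewrite -subr_eq0; apply/eqP/counit_eq0 => m z zP.
have [y' y'P] := acts_bij_div s_bij m y.
suff -> : z = ap h n y' - ap h' n y' by rewrite linearB e subrr.
apply/eqP; rewrite -subr_eq0; apply/eqP/(acts_bij_eq0 (@acts_bij_G s X) (m := m)).
by rewrite scalerBr zP scalerBr -!linearZ y'P subrr.
Qed.

Lemma ctaP X : cta X <-> forall n s, solvable (term X n) s.
Proof.
split=> X_cta n => [s|]; first exact: contraadjusted_solvable.
exact: solvable_contraadjusted.
Qed.

Lemma cta_ext X Y Z (f : mor X Y) (g : mor Y Z) : short_exact f g ->
  cta X -> cta Z -> cta Y.
Proof.
move=> /short_exactP[_ g_surj _ gf] /ctaP X_cta /ctaP Z_cta; apply/ctaP => n s m.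
have [z zP] := Z_cta n s (fun i => ap g n (m i)).
have [y yP] := choice (fun i => g_surj n (z i)).
have wP i : exists x, ap f n x = m i - (y i - s *: y i.+1).
  by apply: gf; rewrite linearB [ap g n (y i - _)]linearB linearZ /= !yP zP subrr.
have [w {}wP] := choice wP; have [x xP] := X_cta n s w.
exists (fun i => y i + ap f n (x i)) => i.
rewrite scalerDr opprD addrACA -linearZ -linearB xP wP addrC.
exact: subrK.
Qed.

(** Equations are lifted, solved upstairs and mapped back; homologically, $R[s^{-1}]$ has projective
    dimension at most one. *)
Lemma cta_epi X Y (f : mor X Y) : epi f -> cta X -> cta Y.
Proof.
move=> f_surj /ctaP X_cta; apply/ctaP => n s m.
have [w wP] := choice (fun i => f_surj n (m i)); have [x xP] := X_cta n s w.
by exists (fun i => ap f n (x i)) => i; rewrite -linearZ -linearB xP.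
Qed.

Lemma cta_zero X : zero_obj X -> cta X.
Proof. by move=> X0; apply/ctaP => n s m; exists (fun=> 0) => i; exact: etrans (X0 n _) (esym (X0 n _)). Qed.
End LocalObjects.

(** * Comparison of Ext over $R$ and over $R[s^{-1}]$ *)

Section Transfer.
Variables (k : ambient) (R : comPzRingType) (s : R).
Implicit Types (N : obj k (localization s)) (X Y Z : obj k R).

Lemma rmor_short_exact N1 N2 N3 (f : mor N1 N2) (g : mor N2 N3) :
  short_exact (rmor f) (rmor g) <-> short_exact f g.
Proof.
rewrite !short_exactP; split=> -[f_inj g_surj gf0 gf]; split.
- by move=> n x y e; apply/rs_inj/(f_inj n); rewrite !rmorE e.
- move=> n z; have [y] := g_surj n (rs z); have [y' <-] := rs_onto y.
  by rewrite rmorE => /rs_inj; exists y'.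
- by move=> n x; apply: rs_inj; rewrite rs0 -!rmorE; apply: gf0.
- move=> n y e; have [|x] := gf n (rs y); first by rewrite rmorE e rs0.
  by have [x' <-] := rs_onto x; rewrite rmorE => /rs_inj; exists x'.
- move=> n x y; have [x' <-] := rs_onto x; have [y' <-] := rs_onto y.
  by rewrite !rmorE => /rs_inj/f_inj->.
- move=> n z; have [z' <-] := rs_onto z; have [y <-] := g_surj n z'.
  by exists (rs y); rewrite rmorE.
- by move=> n x; have [x' <-] := rs_onto x; rewrite !rmorE gf0 rs0.
- move=> n y; have [y' <-] := rs_onto y; rewrite rmorE -rs0 => /rs_inj/gf[x <-].
  by exists (rs x); rewrite rmorE.
Qed.

Lemma rmor_id N N' (f : mor N N') (g : mor N' N) :
  (forall n x, ap (rmor g) n (ap (rmor f) n x) = x) <->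
  forall n x, ap g n (ap f n x) = x.
Proof.
split=> e n x; last by have [x' <-] := rs_onto x; rewrite !rmorE e.
by apply: rs_inj; rewrite -!rmorE e.
Qed.

(** Extend the counit over the restricted extension; the adjunct of the result is a retraction. *)
Lemma ext0_hom_loc N X : ext0 (restriction N) X -> ext0 N (hom_loc s X).
Proof.
move=> e Y f g [_ _ _ fg].
have [r rP] := ext0_extend (counit s X) e ((rmor_short_exact f g).2 fg).
have [h hP] := adjunct r.
apply: (split_of_retraction (r := h)) => //; apply/rmor_id => n x.
rewrite -[RHS]idmE -compmE; apply: counit_inj; first exact: acts_bij_G.
by move=> {}n {}x; rewrite idmE compmE hP rP.
Qed.

Lemma ext0_reflect N N' : ext0 (restriction N) (restriction N') -> ext0 N N'.
Proof.
move=> e Y f g [_ _ _ fg].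
have [r rP] := ext0_retraction e ((rmor_short_exact f g).2 fg).
have [h hP] := rmor_full r.
apply: (split_of_retraction (r := h)) => //; apply/rmor_id => n x.
by rewrite hP rP.
Qed.

(** The coreflection of [Y] is an extension of [N] by [hom_loc s X]; its section, followed by the
    counit of [Y], splits the given extension. *)
Lemma ext0_restriction N X : cta X -> ext0 N (hom_loc s X) -> ext0 (restriction N) X.
Proof.
move=> X_cta e Y f g [_ _ _ fg].
have /short_exactP[f_inj g_surj gf0 gf] := fg.
have [a aP] := adjunct (compm f (counit s X)).
have [b bP] := rmor_full (compm g (counit s Y)).
have G_div := acts_bij_div (@acts_bij_restriction k R s _).
have G_eq0 := acts_bij_eq0 (@acts_bij_restriction k R s _).
have N_div := acts_bij_div (@acts_bij_restriction k R s N).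
have N_eq0 := acts_bij_eq0 (@acts_bij_restriction k R s N).
have ab : short_exact a b.
  apply/rmor_short_exact/short_exactP; split=> [|n z|n x|n y].
  - apply: monoP => n x ax; apply: counit_eq0 => m y yx; apply: (mono0 f_inj).
    rewrite -compmE -aP (_ : ap (rmor a) n y = 0) ?raddf0 //.
    by apply: (G_eq0 _ m); rewrite -linearZ yx.
  (* Lifts [y m] of $z/s^m$ fail to be compatible by elements of [X]; the equations solvable in [X]
     correct them. This is where [cta X] is used. *)
  - have [z' z'P] := choice (fun m => N_div m n z).
    have [y yP] := choice (fun m => g_surj n (z' m)).
    have cP m : exists x, ap f n x = y m - s *: y m.+1.
      apply: gf; rewrite linearB linearZ /= !yP; apply: (N_eq0 m).
      by rewrite scalerBr scalerA -exprSr !z'P subrr.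
    have [c {}cP] := choice cP.
    have [x xP] := (ctaP X).1 X_cta n s c.
    have [|w wP] := @counit_seq k R s Y n (fun m => y m - ap f n (x m)).
      by move=> m; rewrite scalerBr; apply: subr_swap; rewrite -linearZ -linearB xP cP.
    exists w; rewrite bP compmE (wP 0%N w) ?expr0 ?scale1r //.
    by rewrite linearB gf0 subr0 yP -[LHS]scale1r; apply: (z'P 0%N).
  - by rewrite bP compmE aP compmE gf0.
  - move=> by0; have [y' y'P] := choice (fun m => G_div _ m n y).
    have cP m : exists x, ap f n x = ap (counit s Y) n (y' m).
      by apply: gf; rewrite -compmE -bP; apply: (N_eq0 m); rewrite -linearZ y'P.
    have [c {}cP] := choice cP.
    have [|x xP] := @counit_seq k R s X n c.
      move=> m; apply: f_inj; rewrite linearZ /= !cP -linearZ; congr (ap _ _ _).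
      apply/eqP; rewrite -subr_eq0; apply/eqP/(G_eq0 _ m).
      by rewrite scalerBr scalerA -exprSr !y'P subrr.
    exists x; apply/eqP; rewrite -subr_eq0; apply/eqP/counit_eq0 => m w wP.
    have [x' x'P] := G_div _ m n x.
    have -> : w = ap (rmor a) n x' - y' m.
      apply/eqP; rewrite -subr_eq0; apply/eqP/(G_eq0 _ m).
      by rewrite !scalerBr wP -linearZ x'P y'P subrr.
    by rewrite linearB aP compmE (xP m x' x'P) cP subrr.
have [t tP] := ext0_section e ab.
apply: (split_of_section (t := compm (counit s Y) (rmor t))) => // n z.
by rewrite compmE -compmE -bP; apply: (rmor_id t b).2 tP n z.
Qed.
End Transfer.

(** * Mayer-Vietoris *)

(** A sequence that is $q$-divisible modulo the image of [e] becomes truly $q$-divisible after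
    subtracting a sequence from that image, by solving in [P]. The shift by [n] places [z n] at the
    start of the corrected sequence. *)
Lemma divisible_mod_image (R : comPzRingType) (M P : lmodType R) (e : {linear P -> M})
    (q : R) (z : nat -> M) : solvable P q ->
  (forall y, (forall n, y n = q *: y n.+1) -> exists p, e p = y 0%N) ->
  (forall n, exists p, e p = z n - q *: z n.+1) -> forall n, exists p, e p = z n.
Proof.
move=> P_sol q_div zI n; have [p pP] := choice (fun i => zI (n + i)%N).
have [x xP] := P_sol p.
have [|y yP] := q_div (fun i => z (n + i)%N - e (x i)).
  by move=> i; rewrite scalerBr; apply: subr_swap; rewrite addnS -pP -xP linearB linearZ.
by exists (y + x 0%N); rewrite linearD yP addn0 subrK.
Qed.

(* Modulo the image of e every u- or v-divisible sequence vanishes.  If f is   *)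
(* (u+v)-divisible and y_n - u y_(n+1) = f_n, then y is (u+v)-divisible too,   *)
(* since y_n - (u+v) y_(n+1) is u-divisible; so f_n = v y_(n+1), and iterating *)
(* makes every f_0 the start of a v-divisible sequence.                        *)
Lemma divisible_cover (R : comPzRingType) (M P : lmodType R) (e : {linear P -> M})
    (u v : R) : solvable M u -> solvable P u -> solvable P v ->
  (forall y, (forall n, y n = u *: y n.+1) -> exists p, e p = y 0%N) ->
  (forall y, (forall n, y n = v *: y n.+1) -> exists p, e p = y 0%N) ->
  (forall x : M, exists y, (u + v) *: y = x) -> forall x, exists p, e p = x.
Proof.
move=> Mu Pu Pv u_div v_div r_surj m.
pose T f := forall n, exists p, e p = f n - (u + v) *: f n.+1.
have step f : exists f', T f -> T f' /\ forall n, exists p, e p = f n - v *: f' n.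
  have [y yP] := Mu f; exists (fun n => y n.+1) => fT.
  have wI n : exists p, e p = y n - (u + v) *: y n.+1.
    apply: (divisible_mod_image (z := fun n => y n - (u + v) *: y n.+1) Pu u_div) => {}n.
    have [p pP] := fT n; exists p; rewrite pP -!yP !scalerBr !opprB !scalerA.
    rewrite [(u + v) * u]mulrC [LHS]addrACA [RHS]addrACA; congr (_ + _); exact: addrC.
  split=> [n|n]; first exact: wI.
  by have [p pP] := wI n; exists p; rewrite pP -yP scalerDl opprD addrA.
have {step}[F FP] := choice step.
have [d dP] := choice r_surj.
pose f i := iter i F (fun n => iter n d m).
have fT i : T (f i).
  elim: i => [|i IH]; last by have [] := FP _ IH.
  by move=> n; exists 0; rewrite raddf0 /= dP subrr.
apply: (divisible_mod_image (z := fun i => f i 0%N) Pv v_div _ 0%N) => i.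
by have [_] := FP _ (fT i); apply.
Qed.

Section MayerVietoris.
Variables (k : ambient) (R : comPzRingType).
Implicit Types M S : obj k R.

(** If $b=a/u^m$, then $vb=0$, so $(u+v)^mb=u^mb=a$ is killed by the counit; as $u+v$ is injective
    on [M], so is $b$. *)
Lemma counit_eq0_sum u v M n (a : term (G u M) n) : acts_bij (u + v) M ->
  ap (counit u M) n a = 0 -> v *: a = 0 -> a = 0.
Proof.
move=> r_bij a0 va; have G_eq0 := acts_bij_eq0 (@acts_bij_G k R u M).
apply: counit_eq0 => m b bP.
have vb : v *: b = 0.
  by apply: (G_eq0 m); rewrite scalerA mulrC -scalerA bP.
have rb j : (u + v) ^+ j *: b = u ^+ j *: b.
  elim: j => [|j IH]; first by rewrite !expr0.
  rewrite exprSr exprS -!scalerA [(u + v) *: b]scalerDl vb addr0 scalerA mulrC.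
  by rewrite -scalerA IH.
by apply: (acts_bij_eq0 r_bij (m := m)); rewrite -linearZ /= rb bP.
Qed.

(** Together with [counit_eq0_sum] this makes $v$ act bijectively on the kernel of the sum map in
    [mayer_vietoris]. *)
Lemma counit_div_sum u v M n (a : term (G u M) n) (x : term M n) : acts_bij (u + v) M ->
  ap (counit u M) n a = v *: x ->
  exists b : term (G u M) n, v *: b = a /\ ap (counit u M) n b = x.
Proof.
move=> r_bij ax.
have [a' a'P] := choice (fun m => acts_bij_div (@acts_bij_G k R u M) m a).
have [d dP] := choice (fun y => acts_bij_div r_bij 1 y : exists z : term M n, _ = y).
pose am m := ap (counit u M) n (a' m).
have am0 : am 0%N = v *: x by rewrite /am -ax -(a'P 0%N) expr0 scale1r.
have amS m : am m = u *: am m.+1.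
  rewrite /am -linearZ; congr (ap _ _ _); apply/eqP; rewrite -subr_eq0; apply/eqP.
  apply: (acts_bij_eq0 (@acts_bij_G k R u M) (m := m)).
  by rewrite scalerBr scalerA -exprSr !a'P subrr.
(* The terms wanted satisfy $uz_{m+1}=z_m$ and $vz_{m+1}=a_{m+1}$; adding the two equations forces
   this recursion, and [vz] and [zS] recover them separately. *)
pose z := fix z m := if m is m'.+1 then d (z m' + am m'.+1) else x.
have rz m : u *: z m.+1 + v *: z m.+1 = z m + am m.+1 by rewrite -scalerDl -[u + v]expr1 dP.
have vz m : v *: z m = am m.
  elim: m => [|m IH]; first by rewrite am0.
  apply/eqP; rewrite -subr_eq0; apply/eqP/(acts_bij_eq0 r_bij (m := 1)).
  rewrite scalerBr expr1 scalerA mulrC -scalerA scalerDl rz scalerDr IH.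
  by rewrite scalerDl -amS subrr.
have zS m : z m = u *: z m.+1.
  by apply: (addIr (am m.+1)); rewrite -rz vz.
have [b bP] := counit_seq zS.
exists b; split; last by apply: (bP 0%N); rewrite scale1r.
apply/eqP; rewrite -subr_eq0; apply/eqP/counit_eq0 => m c cP.
have [b' b'P] := acts_bij_div (@acts_bij_G k R u M) m b.
suff -> : c = v *: b' - a' m by rewrite linearB linearZ /= (bP m b' b'P) vz subrr.
apply/eqP; rewrite -subr_eq0; apply/eqP/(acts_bij_eq0 (@acts_bij_G k R u M) (m := m)).
by rewrite !scalerBr cP scalerA mulrC -scalerA b'P a'P subrr.
Qed.

(* The kernel of the sum map is G_(uv) M because u and v act bijectively on it *)
Lemma mayer_vietoris u v M : cta M -> cta (G u M) -> cta (G v M) -> acts_bij (u + v) M ->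
  exists S i1 p1 i2 p2 (f : mor (G (u * v) M) S) (e : mor S M),
    @direct_sum2 k R (G u M) (G v M) S i1 p1 i2 p2 /\ short_exact f e.
Proof.
move=> M_cta Gu_cta Gv_cta r_bij.
have r_bij' : acts_bij (v + u) M by rewrite addrC.
have [S [i1 [p1 [i2 [p2 SP]]]]] := @sum2_exists k R (G u M) (G v M).
pose e := addm (compm (counit u M) p1) (compm (counit v M) p2).
exists S, i1, p1, i2, p2.
have S_cta := cta_ext (sum2_short_exact SP) Gu_cta Gv_cta.
have e_surj : epi e.
  move=> n; apply: (@divisible_cover R _ _ _ u v).
  - exact: (ctaP M).1.
  - exact: (ctaP S).1.
  - exact: (ctaP S).1.
  - move=> y /counit_seq[a aP]; exists (ap i1 n a); have [p1i1 _ p2i1 _ _] := SP n.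
    by rewrite !morE p1i1 p2i1 raddf0 addr0; apply: aP; rewrite scale1r.
  - move=> y /counit_seq[a aP]; exists (ap i2 n a); have [_ p2i2 _ p1i2 _] := SP n.
    by rewrite !morE p2i2 p1i2 raddf0 add0r; apply: aP; rewrite scale1r.
  - by move=> x; have [y yP] := acts_bij_div r_bij 1 x; exists y; rewrite -[u + v]expr1.
have [K [i ie]] := kernel_short_exact e_surj.
have /short_exactP[i_inj _ ei0 ei] := ie.
have S_ext n (x y : term S n) : ap p1 n x = ap p1 n y -> ap p2 n x = ap p2 n y -> x = y.
  by move=> e1 e2; have [_ _ _ _ E] := SP n; rewrite -[x]E -[y]E e1 e2.
have K_sum n x : ap (counit u M) n (ap p1 n (ap i n x)) = - ap (counit v M) n (ap p2 n (ap i n x)).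
  by apply/eqP; rewrite -addr_eq0; apply/eqP; have := ei0 n x; rewrite !morE.
have K_pair n a b : ap (counit u M) n a + ap (counit v M) n b = 0 ->
    exists x, ap p1 n (ap i n x) = a /\ ap p2 n (ap i n x) = b.
  move=> ab; have [p1i1 p2i2 p2i1 p1i2 _] := SP n.
  have [|x xP] := ei n (ap i1 n a + ap i2 n b).
    by rewrite !morE !linearD !(p1i1, p2i2, p2i1, p1i2) !raddf0 add0r addr0.
  by exists x; rewrite xP !linearD !(p1i1, p2i2, p2i1, p1i2) add0r addr0.
have K_ext n (x y : term K n) : ap p1 n (ap i n x) = ap p1 n (ap i n y) ->
    ap p2 n (ap i n x) = ap p2 n (ap i n y) -> x = y.
  by move=> e1 e2; apply: i_inj; apply: S_ext.
(* On the component in [G v M] the action of $v$ is bijective anyway; the component in [G u M] is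
   handled by [counit_eq0_sum] and [counit_div_sum]. *)
have Kv : acts_bij v K.
  apply: acts_bijP => n x.
    move=> vx; apply: K_ext; rewrite !raddf0; last first.
      apply: (acts_bij_eq0 (@acts_bij_G k R v M) (m := 1)).
      by rewrite expr1 -!linearZ vx !raddf0.
    apply: (counit_eq0_sum r_bij); last by rewrite -!linearZ vx !raddf0.
    rewrite K_sum (_ : ap p2 n _ = 0) ?raddf0 //.
    apply: (acts_bij_eq0 (@acts_bij_G k R v M) (m := 1)).
    by rewrite expr1 -!linearZ vx !raddf0.
  have [b bP] := acts_bij_div (@acts_bij_G k R v M) 1 (ap p2 n (ap i n x)).
  have [|a [va ax]] := counit_div_sum (a := ap p1 n (ap i n x))
    (x := - ap (counit v M) n b) r_bij.
    by rewrite K_sum -bP expr1 linearZ scalerN.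
  have [|y [ya yb]] := K_pair n a b; first by rewrite ax addNr.
  by exists y; apply: K_ext; rewrite !linearZ /= ?ya ?yb.
have Ku : acts_bij u K.
  apply: acts_bijP => n x.
    move=> ux; apply: K_ext; rewrite !raddf0.
      apply: (acts_bij_eq0 (@acts_bij_G k R u M) (m := 1)).
      by rewrite expr1 -!linearZ ux !raddf0.
    apply: (counit_eq0_sum r_bij'); last by rewrite -!linearZ ux !raddf0.
    apply: oppr_inj; rewrite -K_sum (_ : ap p1 n _ = 0) ?raddf0 ?oppr0 //.
    apply: (acts_bij_eq0 (@acts_bij_G k R u M) (m := 1)).
    by rewrite expr1 -!linearZ ux !raddf0.
  have [a aP] := acts_bij_div (@acts_bij_G k R u M) 1 (ap p1 n (ap i n x)).
  have [|b [vb bx]] := counit_div_sum (a := ap p2 n (ap i n x))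
    (x := - ap (counit u M) n a) r_bij'.
    by apply: oppr_inj; rewrite -K_sum -aP expr1 linearZ scalerN opprK.
  have [|y [ya yb]] := K_pair n a b; first by rewrite bx addrN.
  by exists y; apply: K_ext; rewrite !linearZ /= ?ya ?yb.
have [h hP] := adjunct_local (compm (counit u M) (compm p1 i)) (acts_bij_mul Ku Kv).
have Gu : acts_bij u (G (u * v) M) := acts_bij_mull (@acts_bij_G k R (u * v) M).
have Gv : acts_bij v (G (u * v) M).
  by apply: (@acts_bij_mull _ _ v u); rewrite mulrC; apply: acts_bij_G.
have [j1 j1P] := adjunct_local (counit (u * v) M) Gu.
have [j2 j2P] := adjunct_local (oppm (counit (u * v) M)) Gv.
have [|j jP] := factor_kernel (h := addm (compm i1 j1) (compm i2 j2)) ie.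
  move=> n x; have [p1i1 p2i2 p2i1 p1i2 _] := SP n.
  by rewrite !morE !linearD !(p1i1, p2i2, p2i1, p1i2) !raddf0 add0r addr0 j1P j2P oppmE subrr.
have p1j n x : ap p1 n (ap i n (ap j n x)) = ap j1 n x.
  by have [p1i1 _ _ p1i2 _] := SP n; rewrite jP !morE linearD p1i1 p1i2 addr0.
have p2j n x : ap p2 n (ap i n (ap j n x)) = ap j2 n x.
  by have [_ p2i2 p2i1 _ _] := SP n; rewrite jP !morE linearD p2i2 p2i1 add0r.
have hj n x : ap h n (ap j n x) = x.
  rewrite -compmE -[RHS]idmE; apply: counit_inj; first exact: acts_bij_G.
  by move=> {}n {}x; rewrite compmE idmE hP !compmE p1j j1P.
have jh n x : ap j n (ap h n x) = x.
  apply: K_ext; rewrite ?p1j ?p2j -!compmE; apply: counit_inj => // {}n {}x.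
    by rewrite compmE j1P hP !compmE.
  by rewrite compmE j2P oppmE hP !compmE K_sum opprK.
exists (compm i j), e; split=> //; apply: short_exact_isoml => // n.
by exists (ap h n); [exact: hj | exact: jh].
Qed.
End MayerVietoris.

(** * Finite filtrations by local objects *)

Section Diagrams.
Variables (k : ambient) (R : comPzRingType).
Implicit Types X Y Z V W K M N P S U Q : obj k R.

(** The kernel of [e c] is the preimage of [K] under [c], hence an extension of [K] by [N]. *)
Lemma kernel_comp N P S K M (a : mor N P) (c : mor P S) (f : mor K S) (e : mor S M) :
  short_exact a c -> short_exact f e ->
  exists L (i : mor L P) (a' : mor N L) (b : mor L K),
    [/\ short_exact i (compm e c), short_exact a' b,
        forall n x, ap i n (ap a' n x) = ap a n x
      & forall n x, ap f n (ap b n x) = ap c n (ap i n x)].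
Proof.
move=> ac fe; have /short_exactP[a_inj c_surj ca0 ca] := ac.
have /short_exactP[f_inj e_surj ef0 ef] := fe.
have [L [i ie]] := kernel_short_exact (epi_comp e_surj c_surj).
have /short_exactP[i_inj _ ei0 ei] := ie.
have [|a' a'P] := factor_kernel (h := a) ie; first by move=> n x; rewrite compmE ca0 raddf0.
have [|b bP] := factor_kernel (h := compm c i) fe.
  by move=> n x; rewrite compmE -compmE ei0.
exists L, i, a', b; split=> // [|n x]; last by rewrite bP compmE.
apply/short_exactP; split=> [|n x|n x|n x].
- by apply: monoP => n x /(congr1 (ap i n)); rewrite a'P raddf0 => /mono0->.
- have [p cp] := c_surj n (ap f n x).
  have [|l il] := ei n p; first by rewrite compmE cp ef0.
  by exists l; apply: f_inj; rewrite bP compmE il cp.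
- by apply: f_inj; rewrite bP compmE a'P ca0 raddf0.
- move=> /(congr1 (ap f n)); rewrite bP raddf0 compmE => /ca[y yP].
  by exists y; apply: i_inj; rewrite a'P yP.
Qed.

(** Here $C=W/V$ contains $Q/V=Z$, with quotient $W/Q=U$. *)
Lemma cokernel_comp V Q Z W U (b : mor V Q) (g : mor Q Z) (m : mor Q W) (q : mor W U) :
  short_exact b g -> short_exact m q ->
  exists C (p : mor W C) (a : mor Z C) (c : mor C U),
    short_exact (compm m b) p /\ short_exact a c.
Proof.
move=> bg mq; have /short_exactP[b_inj g_surj gb0 gb] := bg.
have /short_exactP[m_inj q_surj qm0 qm] := mq.
have [C [p mp]] := cokernel_short_exact (mono_comp m_inj b_inj).
have /short_exactP[_ p_surj pm0 pm] := mp.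
have [|a aP] := factor_cokernel (h := compm p m) bg.
  by move=> n x; rewrite compmE -[ap m n _]compmE pm0.
have [|c cP] := factor_cokernel (h := q) mp; first by move=> n x; rewrite compmE qm0.
exists C, p, a, c; split=> //; apply/short_exactP; split=> [|n x|n x|n x].
- apply: monoP => n x; have [y <-] := g_surj n x; rewrite aP compmE => /pm[v].
  by rewrite compmE => /m_inj<-; rewrite gb0.
- by have [y <-] := q_surj n x; exists (ap p n y); rewrite cP.
- by have [y <-] := g_surj n x; rewrite aP compmE cP qm0.
- have [y <-] := p_surj n x; rewrite cP => /qm[z <-].
  by exists (ap g n z); rewrite aP compmE.
Qed.

Lemma sum2_exact X1 Y1 Z1 X2 Y2 Z2 (f1 : mor X1 Y1) (g1 : mor Y1 Z1)
    (f2 : mor X2 Y2) (g2 : mor Y2 Z2) X Y Z i1 p1 i2 p2 j1 q1 j2 q2 l1 r1 l2 r2 :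
  short_exact f1 g1 -> short_exact f2 g2 ->
  @direct_sum2 k R X1 X2 X i1 p1 i2 p2 -> @direct_sum2 k R Y1 Y2 Y j1 q1 j2 q2 ->
  @direct_sum2 k R Z1 Z2 Z l1 r1 l2 r2 ->
  short_exact (addm (compm j1 (compm f1 p1)) (compm j2 (compm f2 p2)))
              (addm (compm l1 (compm g1 q1)) (compm l2 (compm g2 q2))).
Proof.
move=> /short_exactP[f1_inj g1_surj gf01 gf1] /short_exactP[f2_inj g2_surj gf02 gf2].
move=> SX SY SZ; apply/short_exactP; split=> [|n z|n x|n y].
- apply: monoP => n x; rewrite !morE => e; have [q1j1 q2j2 q2j1 q1j2 _] := SY n.
  have := congr1 (ap q1 n) e; have := congr1 (ap q2 n) e.
  rewrite !linearD !(q1j1, q2j2, q2j1, q1j2) !raddf0 addr0 add0r.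
  move=> /(mono0 f2_inj) x2 /(mono0 f1_inj) x1; have [_ _ _ _ /(_ x)<-] := SX n.
  by rewrite x1 x2 !raddf0 addr0.
- have [y1 gy1] := g1_surj n (ap r1 n z); have [y2 gy2] := g2_surj n (ap r2 n z).
  exists (ap j1 n y1 + ap j2 n y2); have [q1j1 q2j2 q2j1 q1j2 _] := SY n.
  have [_ _ _ _ /(_ z) zE] := SZ n.
  rewrite !morE [ap q1 n _]linearD [ap q2 n _]linearD !(q1j1, q2j2, q2j1, q1j2).
  by rewrite addr0 add0r gy1 gy2.
- have [q1j1 q2j2 q2j1 q1j2 _] := SY n; rewrite !morE.
  rewrite [ap q1 n _]linearD [ap q2 n _]linearD !(q1j1, q2j2, q2j1, q1j2).
  by rewrite addr0 add0r gf01 gf02 !raddf0 addr0.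
- rewrite !morE => e; have [r1l1 r2l2 r2l1 r1l2 _] := SZ n.
  have := congr1 (ap r1 n) e; have := congr1 (ap r2 n) e.
  rewrite !linearD !(r1l1, r2l2, r2l1, r1l2) !raddf0 addr0 add0r.
  move=> /gf2[x2 fx2] /gf1[x1 fx1]; exists (ap i1 n x1 + ap i2 n x2).
  have [p1i1 p2i2 p2i1 p1i2 _] := SX n; have [_ _ _ _ /(_ y) yE] := SY n.
  rewrite !morE [ap p1 n _]linearD [ap p2 n _]linearD !(p1i1, p2i2, p2i1, p1i2).
  by rewrite addr0 add0r fx1 fx2.
Qed.

Lemma short_exact_isomm X Y Y' Z (f : mor X Y) (g : mor Y Z) (h : mor Y Y') (h' : mor Y' Y) :
  isom h -> (forall n y, ap h' n (ap h n y) = y) ->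
  short_exact f g -> short_exact (compm h f) (compm g h').
Proof.
move=> h_iso h'h /short_exactP[f_inj g_surj gf0 gf]; apply/short_exactP; split=> [|n z|n x|n y].
- by apply: mono_comp => //; apply: isom_mono.
- by have [y <-] := g_surj n z; exists (ap h n y); rewrite compmE h'h.
- by rewrite !compmE h'h gf0.
- have [y' <-] := isom_epi h_iso y; rewrite compmE h'h => /gf[x <-].
  by exists x; rewrite compmE.
Qed.

Lemma short_exact_zeror X Y Z (f : mor X Y) (g : mor Y Z) :
  zero_obj Z -> short_exact f g -> isom f.
Proof.
move=> Z0 /short_exactP[f_inj _ _ gf]; apply: isomP => // n y.
by apply: gf; apply: Z0.
Qed.

Lemma short_exact_isom X Y Z (f : mor Y Z) : zero_obj X -> isom f ->
  short_exact (zerom X Y) f.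
Proof.
move=> X0 f_iso; apply/short_exactP; split=> [n x y _|n z|n x|n y e].
- exact: etrans (X0 n x) (esym (X0 n y)).
- exact: isom_epi.
- by rewrite morE raddf0.
- by exists 0; rewrite raddf0 (mono0 (isom_mono f_iso) e).
Qed.

Lemma zero_isom X Y (f : mor X Y) : isom f -> zero_obj X -> zero_obj Y.
Proof.
move=> f_iso X0 n y; have [x <-] := isom_epi f_iso y.
by rewrite (X0 n x) raddf0.
Qed.
End Diagrams.

(** * Objects filtered by restrictions from the localizations *)

Section Filtered.
Variables (k : ambient) (R : comPzRingType) (d : nat) (s : 'I_d -> R) (L : class_system k).
Implicit Types X Y Z F : obj k R.

(** Iterated extensions without an ambient object, suited to induction; [filtered_filtered_locally]
    recovers an actual filtration. *)
Inductive filtered : obj k R -> Prop :=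
| filtered_zero X : zero_obj X -> filtered X
| filtered_step X Y j (D : obj k (localization (s j)))
    (f : mor X Y) (g : mor Y (restriction D)) :
    filtered X -> L D -> short_exact f g -> filtered Y.

Lemma filtered_isom X Y (h : mor X Y) : isom h -> filtered X -> filtered Y.
Proof.
move=> + FX; case: X / FX Y h => [X X0|X X' j D f g FX LD fg] Y h h_iso.
  by apply: filtered_zero; apply: zero_isom X0.
have [h' [_ _ h'h]] := isom_inv h_iso.
exact: filtered_step FX LD (short_exact_isomm h_iso h'h fg).
Qed.

(** Induction on the filtration of [Z]: the preimage in [Y] of its last proper step is again an
    extension, with the same local quotient on top. *)
Lemma filtered_ext X Y Z (f : mor X Y) (g : mor Y Z) :
  short_exact f g -> filtered X -> filtered Z -> filtered Y.
Proof.
move=> fg FX FZ; elim: FZ Y f g fg => {Z} [Z Z0|Z' Z j D f' g' _ IH LD f'g'] Y f g fg.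
  exact: filtered_isom (short_exact_zeror Z0 fg) FX.
have [P [i [a [b [ie ab _ _]]]]] := kernel_comp fg f'g'.
exact: filtered_step (IH _ _ _ ab) LD ie.
Qed.

Lemma filtered_local j (D : obj k (localization (s j))) : L D -> filtered (restriction D).
Proof.
move=> LD; have [Z Z0] := zero_exists k R.
apply: filtered_step (filtered_zero Z0) LD (short_exact_isom Z0 (@isom_id _ _ _)).
Qed.

Definition subobject F P (f : mor P F) : {P : obj k R & mor P F} :=
  existT (fun P => mor P F) P f.

Definition local_step F (a b : {P : obj k R & mor P F}) : Prop :=
  exists j (D : obj k (localization (s j))) (q : mor (projT1 b) (restriction D)),
    [/\ L D, epi q & forall n x, ap q n x = 0 <->
                                 exists y, ap (projT2 a) n y = ap (projT2 b) n x].

Definition sub_le F (a b : {P : obj k R & mor P F}) : Prop :=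
  forall n x, exists y, ap (projT2 b) n y = ap (projT2 a) n x.

(** The chain of [X] is pushed into [Y], then continued by [Y] itself forever, because the record
    [filtration] asks for inclusions at every index. *)
Lemma filtered_chain F : filtered F ->
  exists (c : nat -> {P : obj k R & mor P F}) (N : nat),
  [/\ forall i, mono (projT2 (c i)), zero_obj (projT1 (c 0%N)), isom (projT2 (c N)),
      forall i, sub_le (c i) (c i.+1)
    & forall i, (i < N)%N -> local_step (c i) (c i.+1)].
Proof.
elim=> {F} [X X0|X Y j D f g _ [c [N [c_mono c0 cN c_le c_step]]] LD fg].
  exists (fun=> subobject (idm X)), 0%N; split=> //= [i||i n x].
  - exact/isom_mono/isom_id.
  - exact: isom_id.
  - by exists x.
have /short_exactP[f_inj g_surj gf0 gf] := fg.
pose c' i : {P : obj k R & mor P Y} :=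
  if (i <= N)%N then subobject (compm f (projT2 (c i)))
  else subobject (idm Y).
have c'lo i : (i <= N)%N -> c' i = subobject (compm f (projT2 (c i))).
  by rewrite /c' => ->.
have c'hi i : (N < i)%N -> c' i = subobject (idm Y) by rewrite /c' ltnNge => /negPf->.
exists c', N.+1; split=> [i|||i|i].
- case: (leqP i N) => [/c'lo->|/c'hi->] /=; first exact: mono_comp.
  exact/isom_mono/isom_id.
- by rewrite c'lo.
- by rewrite c'hi //=; apply: isom_id.
- case: (ltnP i N) => [iN|Ni].
    rewrite (c'lo i (ltnW iN)) (c'lo _ iN) => n x /=.
    by have [y yP] := c_le i n x; exists y; rewrite !compmE yP.
  by rewrite (c'hi i.+1 Ni) => n x /=; exists (ap (projT2 (c' i)) n x); rewrite idmE.
rewrite ltnS leq_eqVlt => /orP[/eqP->|iN].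
  rewrite (c'lo N (leqnn N)) (c'hi _ (leqnn N.+1)).
  exists j, D, g; split=> //= n y; rewrite idmE.
  split=> [/gf[x <-]|[x]]; last by rewrite compmE => <-; apply: gf0.
  by have [x' <-] := isom_epi cN x; exists x'; rewrite compmE.
rewrite (c'lo i (ltnW iN)) (c'lo _ iN).
have [j' [D' [q [LD' q_surj qP]]]] := c_step i iN.
exists j', D', q; split=> //= n x; rewrite qP compmE.
by split=> -[y yP]; exists y; rewrite ?compmE ?yP //; apply: f_inj; rewrite -compmE.
Qed.

Lemma filtered_filtered_locally F : filtered F -> filtered_locally L s F.
Proof.
move=> /filtered_chain[c [N [c_mono c0 cN c_le c_step]]].
have [inc incP] := dchoice (fun i => factor_mono (@c_mono i.+1) (@c_le i)).
exists (@Filtration k R F N (fun i => projT1 (c i)) (fun i => projT2 (c i)) inc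
  (fun i _ => c_mono i) (fun i _ => incP i) c0 cN).
move=> i /c_step[j [D [q [LD q_surj qP]]]]; exists j, D, q; split=> //.
apply/short_exactP; split=> //= [n x y e|n x|n y /qP[x xP]].
- by apply: (c_mono i); rewrite -(incP i n x) -(incP i n y) e.
- by apply/qP; exists x; rewrite incP.
- by exists x; apply: (c_mono i.+1); rewrite incP.
Qed.

Lemma filtered_locally_ind (C : obj k R -> Prop) F : iso_closed C ->
  (forall X, zero_obj X -> C X) ->
  (forall X Y Z (f : mor X Y) (g : mor Y Z), short_exact f g -> C X -> C Z -> C Y) ->
  (forall j (D : obj k (localization (s j))), L D -> C (restriction D)) ->
  filtered_locally L s F -> C F.
Proof.
move=> C_iso C0 C_ext CD [phi phiP].
suff Ci i : (i <= fil_len phi)%N -> C (fil phi i).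
  exact: C_iso (@fil_top _ _ _ phi) (Ci _ (leqnn _)).
elim: i => [|i IH] iN; first exact/C0/fil_bottom.
have [j [D [q [LD iq]]]] := phiP i iN.
exact: C_ext iq (IH (ltnW iN)) (CD j D LD).
Qed.
End Filtered.

(* For 1 = c_1 s_1 + ... + c_d s_d, objects on which a partial sum of the      *)
(* c_j s_j acts bijectively are cut by Mayer-Vietoris into objects on which a  *)
(* shorter partial sum, or a single s_j, acts bijectively.                     *)
Lemma local_induction k (R : comPzRingType) d (s : 'I_d -> R) (C Q : obj k R -> Prop) :
  unit_ideal s -> (forall X, C X -> cta X) -> (forall t X, C X -> C (G t X)) ->
  (forall X, zero_obj X -> Q X) ->
  (forall j X, C X -> acts_bij (s j) X -> Q X) ->
  (forall K X1 X2 S M i1 p1 i2 p2 (f : mor K S) (e : mor S M),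
     C K -> C X1 -> C X2 -> C M -> @direct_sum2 k R X1 X2 S i1 p1 i2 p2 ->
     short_exact f e -> Q K -> Q X1 -> Q X2 -> Q M) ->
  forall M, C M -> Q M.
Proof.
move=> [c c1] C_cta C_G Q0 Q_loc Q_step.
suff Qr (r : seq 'I_d) M : C M -> acts_bij (\sum_(j <- r) c j * s j) M -> Q M.
  by move=> M CM; apply: (Qr (index_enum _)) => // n; rewrite c1; exists id => x; rewrite scale1r.
elim: r M => [|j r IH] M CM; rewrite ?big_nil ?big_cons => r_bij.
  by apply: Q0 => n x; apply: (acts_bij_eq0 r_bij (m := 1)); rewrite expr1 scale0r.
set u := c j * s j in r_bij; set v := \sum_(_ <- _) _ in r_bij IH.
have [] := mayer_vietoris (C_cta _ CM) (C_cta _ (C_G u _ CM)) (C_cta _ (C_G v _ CM)) r_bij.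
move=> S [i1 [p1 [i2 [p2 [f [e [SP fe]]]]]]].
apply: (Q_step _ _ _ _ _ _ _ _ _ _ _ _ _ _ _ SP fe) => //; try exact: C_G.
- apply: IH; first exact: C_G.
  by apply: (@acts_bij_mull _ _ v u); rewrite mulrC; apply: acts_bij_G.
- apply: (Q_loc j); first exact: C_G.
  by apply: (@acts_bij_mull _ _ (s j) (c j)); rewrite mulrC; apply: acts_bij_G.
- by apply: IH; [exact: C_G | exact: acts_bij_G].
Qed.

(** Covers of [X1] and [X2] add up to a cover of [S]; composed with [e] it covers [M], with kernel
    an extension of [K] by the two old kernels. It serves (b) with [C] the class [E] and (c) with
    [C] the class [B]. *)
Lemma local_cover k (R : comPzRingType) d (s : 'I_d -> R) (C H : obj k R -> Prop) :
  unit_ideal s -> (forall X, C X -> cta X) -> (forall t X, C X -> C (G t X)) ->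
  (forall X, zero_obj X -> C X) ->
  (forall X Y Z (f : mor X Y) (g : mor Y Z), short_exact f g -> C X -> C Z -> C Y) ->
  (forall X, zero_obj X -> H X) ->
  (forall X1 X2 S i1 p1 i2 p2, @direct_sum2 k R X1 X2 S i1 p1 i2 p2 -> H X1 -> H X2 -> H S) ->
  (forall j X, C X -> acts_bij (s j) X ->
     exists N P (f : mor N P) (g : mor P X), [/\ C N, H P & short_exact f g]) ->
  forall X, C X -> exists N P (f : mor N P) (g : mor P X), [/\ C N, H P & short_exact f g].
Proof.
move=> s1 C_cta C_G C0 C_ext H0 H_sum cover.
apply: (local_induction s1 C_cta C_G) => [X X0|j X|].
- exists X, X, (zerom X X), (idm X); split; [exact: C0 | exact: H0 |].
  exact/short_exact_isom/isom_id.
- exact: cover.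
move=> K X1 X2 S M i1 p1 i2 p2 f e CK _ _ _ SP fe _ [N1 [P1 [f1 [g1 [CN1 HP1 fg1]]]]].
move=> [N2 [P2 [f2 [g2 [CN2 HP2 fg2]]]]].
have [N [j1 [q1 [j2 [q2 NP]]]]] := sum2_exists N1 N2.
have [P [l1 [r1 [l2 [r2 PP]]]]] := sum2_exists P1 P2.
have fg := sum2_exact fg1 fg2 NP PP SP.
have [L [i [a [b [ie ab _ _]]]]] := kernel_comp fg fe.
exists L, P, i; eexists; split; last exact: ie.
  exact: C_ext ab (C_ext _ _ _ _ _ (sum2_short_exact NP) CN1 CN2) CK.
exact: H_sum PP HP1 HP2.
Qed.

(** * Direct sums indexed by a cover *)

Section Sums.
Variables (k : ambient) (R : comPzRingType) (d : nat).
Implicit Types (D : 'I_d -> obj k R).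

Definition sum_of (L : 'I_d -> obj k R -> Prop) (X : obj k R) : Prop :=
  exists D, (forall j, L j (D j)) /\ exists i p, direct_sum (D := D) (X := X) i p.

Lemma sum_of_sum2 L X1 X2 S i1 p1 i2 p2 :
  (forall j Y1 Y2 S' i1 p1 i2 p2, @direct_sum2 k R Y1 Y2 S' i1 p1 i2 p2 ->
     L j Y1 -> L j Y2 -> L j S') ->
  @direct_sum2 k R X1 X2 S i1 p1 i2 p2 -> sum_of L X1 -> sum_of L X2 -> sum_of L S.
Proof.
move=> L_sum SP [D1 [LD1 [a1 [b1 S1]]]] [D2 [LD2 [a2 [b2 S2]]]].
have [D DP] := dchoice (fun j => sum2_exists (D1 j) (D2 j)).
have [l1 {}DP] := dchoice DP; have [r1 {}DP] := dchoice DP.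
have [l2 {}DP] := dchoice DP; have [r2 {}DP] := dchoice DP.
exists D; split=> [j|]; first exact: L_sum (DP j) (LD1 j) (LD2 j).
exists (fun j => addm (compm i1 (compm (a1 j) (r1 j))) (compm i2 (compm (a2 j) (r2 j)))).
exists (fun j => addm (compm (l1 j) (compm (b1 j) p1)) (compm (l2 j) (compm (b2 j) p2))).
move=> n; have [p1i1 p2i2 p2i1 p1i2 SE] := SP n.
have [ba1 ba1' ab1] := S1 n; have [ba2 ba2' ab2] := S2 n.
split=> [j x|j l x jl|y].
- have [_ _ _ _ DE] := DP j n; rewrite !morE ![ap p1 n _]linearD ![ap p2 n _]linearD.
  by rewrite !(p1i1, p2i2, p2i1, p1i2) addr0 add0r ba1 ba2 DE.
- rewrite !morE ![ap p1 n _]linearD ![ap p2 n _]linearD.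
  by rewrite !(p1i1, p2i2, p2i1, p1i2) addr0 add0r ba1' // ba2' // !raddf0 addr0.
- under eq_bigr => j _.
    have [r1l1 r2l2 r2l1 r1l2 _] := DP j n.
    rewrite !morE ![ap (r1 j) n _]linearD ![ap (r2 j) n _]linearD.
    rewrite !(r1l1, r2l2, r2l1, r1l2) addr0 add0r; over.
  by rewrite big_split /= -!linear_sum ab1 ab2 SE.
Qed.

Lemma sum_of_zero (L : 'I_d -> obj k R -> Prop) X : (forall j Y, zero_obj Y -> L j Y) ->
  zero_obj X -> sum_of L X.
Proof.
move=> L0 X0; exists (fun=> X); split=> [j|]; first exact: L0.
exists (fun=> idm X), (fun=> idm X) => n; split=> [j x|j l x _|y].
- exact: etrans (X0 n _) (esym (X0 n _)).
- exact: X0.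
- exact: etrans (X0 n _) (esym (X0 n _)).
Qed.

Lemma sum_of_local (L : 'I_d -> obj k R -> Prop) l X : (forall j Y, zero_obj Y -> L j Y) ->
  L l X -> sum_of L X.
Proof.
move=> L0 LX; have [Z Z0] := zero_exists k R.
pose D j := if j == l then X else Z.
(* Stated for an arbitrary boolean, so that the type of the summand reduces by cases. *)
have ip b : exists (i : mor (if b then X else Z) X) (p : mor X (if b then X else Z)),
    (forall n x, ap p n (ap i n x) = x) /\
    (forall n x, ap i n (ap p n x) = if b then x else 0).
  case: b; first by exists (idm X), (idm X); split=> n x; rewrite !idmE.
  exists (zerom Z X), (zerom X Z); split=> n x; last by rewrite zeromE.
  exact: etrans (Z0 n _) (esym (Z0 n _)).
have [i {}ip] := dchoice (fun j => ip (j == l)); have [p {}ip] := dchoice ip.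
exists D; split=> [j|]; first by rewrite /D; case: eqP => [->|_] //; apply: L0.
exists i, p => n; split=> [j x|j m x jm|y].
- exact: (ip j).1.
- have Dz a (z : term (D a) n) : a != l -> z = 0.
    by rewrite /D in z *; case: eqP z => // _ z _; apply: Z0.
  case: (altP (m =P l)) => [ml|]; last exact: Dz.
  by rewrite (Dz j x) ?raddf0 // -ml.
- rewrite (bigD1 l) //= (ip l).2 eqxx big1 ?addr0 // => j /negPf jl.
  by rewrite (ip j).2 jl.
Qed.

End Sums.

(** The kernel of the first projection is the sum of the remaining terms, so induction on [d]
    applies. *)
Lemma sum_of_closed k (R : comPzRingType) (C : obj k R -> Prop) :
  (forall X, zero_obj X -> C X) ->
  (forall X Y Z (f : mor X Y) (g : mor Y Z), short_exact f g -> C X -> C Z -> C Y) ->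
  forall d (D : 'I_d -> obj k R) X i p, (forall j, C (D j)) ->
    direct_sum (D := D) (X := X) i p -> C X.
Proof.
move=> C0 C_ext; elim=> [|d IH] D X i p CD SP.
  by apply: C0 => n x; have [_ _ /(_ x)<-] := SP n; rewrite big_ord0.
have p_surj : epi (p ord0) by move=> n z; have [pi _ _] := SP n; exists (ap (i ord0) n z).
have [K [j jp]] := kernel_short_exact p_surj.
have /short_exactP[j_inj _ pj0 pj] := jp.
apply: (C_ext _ _ _ _ _ jp) => //.
have i'_ex l : exists i' : mor (D (lift ord0 l)) K, forall n x, ap j n (ap i' n x) = ap (i (lift ord0 l)) n x.
  by apply: factor_kernel jp _ => n w; have [_ pi0 _] := SP n; apply: pi0; rewrite eq_sym neq_lift.
have [i' i'P] := dchoice i'_ex.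
apply: (IH (fun l => D (lift ord0 l)) K i' (fun l => compm (p (lift ord0 l)) j)) => // n.
have [pi pi0 ip] := SP n; split=> [l x|l m x lm|y].
- by rewrite compmE i'P pi.
- by rewrite compmE i'P pi0 // (inj_eq lift_inj).
- apply: j_inj; rewrite linear_sum -[RHS]ip big_ord_recl /= pj0 raddf0 add0r.
  by apply: eq_bigr => l _; rewrite i'P compmE.
Qed.

(** * Cotorsion pairs over a very colocal system *)

Section CotorsionSystem.
Variables (k : ambient) (Rcal : comPzRingType -> Prop).
Hypothesis Rcal_loc : forall (R : comPzRingType) (s : R), Rcal R -> Rcal (localization s).
Variables E A B : class_system k.
Hypothesis E_iso : forall R, Rcal R -> iso_closed (@E R).
Hypothesis E_cta : forall R, Rcal R -> forall X, @E R X -> cta X.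
Hypothesis E_ext : forall R, Rcal R -> ext_closed_in cta (@E R).
Hypothesis E_summand : forall R, Rcal R -> summand_closed_in cta (@E R).
Hypothesis E_very_colocal : very_colocal Rcal E.
Hypothesis A_sub_E : forall R, Rcal R -> forall X, @A R X -> @E R X.
Hypothesis B_sub_E : forall R, Rcal R -> forall X, @B R X -> @E R X.
Hypothesis AB_pair : forall R, Rcal R ->
  hereditary_complete_cotorsion_pair (@E R) (@A R) (@B R).

Let E_coascent : coascent Rcal E := E_very_colocal.1.1.
Let E_codescent : codescent Rcal E := E_very_colocal.1.2.
Let E_direct : direct_image Rcal E := E_very_colocal.2.

(** * Orthogonality and closure properties over a fixed ring *)

Section OneRing.
Variables (R : comPzRingType) (HR : Rcal R).
Implicit Types X Y Z V U : obj k R.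

Lemma E_short_exact X Y Z (f : mor X Y) (g : mor Y Z) :
  short_exact f g -> E X -> E Z -> E Y.
Proof.
move=> fg EX EZ; have X_cta := E_cta HR EX; have Z_cta := E_cta HR EZ.
exact: (E_ext HR X_cta (cta_ext fg X_cta Z_cta) Z_cta fg).
Qed.

(** Closure under summands is assumed inside [cta]; a summand and its complement are quotients of
    [Y], hence contraadjusted. *)
Lemma E_of_summand X Y : summand X Y -> E Y -> E X.
Proof.
move=> [Z [i1 [p1 [i2 [p2 [_ SP]]]]]] EY; have Y_cta := E_cta HR EY.
have p1_surj : epi p1 by move=> n x; have [pi _ _ _ _] := SP n; exists (ap i1 n x).
have p2_surj : epi p2 by move=> n x; have [_ pi _ _ _] := SP n; exists (ap i2 n x).
apply: (E_summand HR (cta_epi p1_surj Y_cta) Y_cta _ EY).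
exists Z, i1, p1, i2, p2; split=> //; exact: cta_epi p2_surj Y_cta.
Qed.

(* R[0^-1] = 0, over which the empty family generates the unit ideal *)
Lemma E_zero X : zero_obj X -> E X.
Proof.
move=> X0; have [Z Z0] := zero_exists k (localization (0 : R)).
have EZ : E Z.
  apply: (E_codescent (d := 0) (s := fun=> 0)); [exact: Rcal_loc | | exact: cta_zero | by case].
  exists (fun=> 0); rewrite big_ord0.
  by have [t <-] := toloc_inverts (0 : R); rewrite raddf0 mul0r.
have EZ' := E_direct HR EZ.
have Z0' : zero_obj (restriction Z).
  by move=> n x; have [x' <-] := rs_onto x; rewrite (Z0 n x') rs0.
apply: (E_iso HR (f := zerom (restriction Z) X) _ EZ') => n; exists (fun=> 0) => x.
  exact: etrans (esym (Z0' n _)) (esym (Z0' n _)).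
exact: etrans (X0 n _) (esym (X0 n _)).
Qed.

Lemma E_G s X : E X -> E (G s X).
Proof. by move=> EX; apply: E_direct HR _; apply: E_coascent. Qed.

Lemma ext0_E Z X : E Z -> E X -> Ext1_zero (E (R := R)) Z X -> ext0 Z X.
Proof.
move=> EZ EX e Y f g [_ _ _ fg]; apply: e; split=> //.
exact: E_short_exact fg EX EZ.
Qed.

Lemma E_ext0 Z X : ext0 Z X -> Ext1_zero (E (R := R)) Z X.
Proof. by move=> e Y f g [_ _ _ fg]; apply: e. Qed.

Lemma AB_ext0 Z X : A Z -> B X -> ext0 Z X.
Proof.
move=> AZ BX; have [[_ AP] _ _] := AB_pair HR.
by apply: ext0_E; [exact: A_sub_E | exact: B_sub_E | exact: ((AP Z).1 AZ).2].
Qed.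

Lemma A_intro Z : E Z -> (forall X, B X -> ext0 Z X) -> A Z.
Proof.
move=> EZ e; have [[_ AP] _ _] := AB_pair HR.
by apply/AP; split=> // X BX; apply/E_ext0/e.
Qed.

Lemma B_intro X : E X -> (forall Z, A Z -> ext0 Z X) -> B X.
Proof.
move=> EX e; have [[BP _] _ _] := AB_pair HR.
by apply/BP; split=> // Z AZ; apply/E_ext0/e.
Qed.

Lemma A_short_exact X Y Z (f : mor X Y) (g : mor Y Z) :
  short_exact f g -> A X -> A Z -> A Y.
Proof.
move=> fg AX AZ; apply: A_intro => [|W BW].
  by apply: E_short_exact fg _ _; apply: A_sub_E.
by apply: ext0_extl fg _ _; apply: AB_ext0.
Qed.

Lemma B_short_exact X Y Z (f : mor X Y) (g : mor Y Z) :
  short_exact f g -> B X -> B Z -> B Y.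
Proof.
move=> fg BX BZ; apply: B_intro => [|W AW].
  by apply: E_short_exact fg _ _; apply: B_sub_E.
by apply: ext0_extr fg _ _; apply: AB_ext0.
Qed.

Lemma A_of_summand X Y : summand X Y -> A Y -> A X.
Proof.
move=> XY AY; apply: A_intro => [|W BW]; first exact: E_of_summand XY (A_sub_E HR AY).
exact: ext0_summandl XY (AB_ext0 AY BW).
Qed.

Lemma B_of_summand X Y : summand X Y -> B Y -> B X.
Proof.
move=> XY BY; apply: B_intro => [|W AW]; first exact: E_of_summand XY (B_sub_E HR BY).
exact: ext0_summandr XY (AB_ext0 AW BY).
Qed.

Lemma A_isom X Y (f : mor X Y) : isom f -> A X -> A Y.
Proof. by move=> /isom_inv[g [/isom_summand YX _ _]]; apply: A_of_summand. Qed.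

Lemma A_zero X : zero_obj X -> A X.
Proof. by move=> X0; apply: A_intro => [|W _]; [exact: E_zero | exact: ext0_zero]. Qed.

Lemma B_zero X : zero_obj X -> B X.
Proof.
move=> X0; apply: B_intro => [|Z _]; first exact: E_zero.
move=> Y f g [_ _ _ fg]; apply: (split_of_retraction (r := zerom Y X)) => // n x.
exact: etrans (X0 n _) (esym (X0 n _)).
Qed.

(* Given 0 -> Z -> Y -> W -> 0 with W in A, cover Y by some U in A with kernel *)
(* in B.  The kernel U' of U -> W is in A by heredity, so U' -> Z lifts to Y',  *)
(* the lift extends to U -> Y', and U -> Y' -> Z descends to a retraction.      *)
Lemma B_cokernel X Y' Z (f : mor X Y') (g : mor Y' Z) :
  short_exact f g -> B X -> B Y' -> E Z -> B Z.
Proof.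
move=> fg BX BY EZ; apply: B_intro => // W AW Y i q [_ _ _ iq].
have EW := A_sub_E HR AW; have EY := E_short_exact iq EZ EW.
have [_ compl hered] := AB_pair HR.
have [[V [U [a [b [BV AU [_ _ _ ab]]]]]] _] := compl Y EY.
have [U' [j [a' [b' [jq ab' ja' ib']]]]] := kernel_comp ab iq.
have EU' : E U' := E_short_exact ab' (B_sub_E HR BV) EZ.
have AU' : A U' by apply: (hered _ _ _ j _ _ AU AW); split; [exact: EU' | exact: (A_sub_E HR AU) | exact: EW | exact: jq].
have [t tP] := ext0_lift b' (AB_ext0 AU' BX) fg.
have [r rP] := ext0_extend t (AB_ext0 AW BY) jq.
have [|h hP] := factor_cokernel (h := compm g r) ab.
  have /short_exactP[_ _ ba0 _] := ab'.
  by move=> n v; rewrite -ja' compmE rP tP ba0.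
apply: (split_of_retraction (r := h)) => // n z.
have /short_exactP[_ b'_surj _ _] := ab'; have [u <-] := b'_surj n z.
by rewrite ib' hP compmE rP tP.
Qed.
End OneRing.

(** Apply antilocality to the cover of $R$ by $s$ and $1$: a restricted object has a one-step
    filtration. *)
Lemma antilocal_direct_image : antilocal Rcal A -> direct_image Rcal A.
Proof.
move=> A_anti R s N HR AN.
pose s2 (j : 'I_2) : R := if nat_of_ord j is 0%N then s else 1.
have s2_unit : unit_ideal s2.
  exists (fun j => if nat_of_ord j is 0%N then 0 else 1).
  by rewrite big_ord_recl big_ord1 /= mul0r add0r mul1r.
apply/(A_anti R 2 s2 _ HR s2_unit).
exists (restriction N); split; first exact/isom_summand/isom_id.
exact/filtered_filtered_locally/(@filtered_local k R 2 s2 (@A) ord0 N).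
Qed.

(** Coascent moves a test object from $R[s^{-1}]$ to $R$ by the direct image property of [A]. For
    codescent, a test object is a summand of one filtered by local objects, against which Ext is
    computed over the $R[s_j^{-1}]$. *)
Lemma antilocal_colocal : antilocal Rcal A -> colocal Rcal B.
Proof.
move=> A_anti; have A_direct := antilocal_direct_image A_anti; split.
  move=> R s X HR BX; have HRs := Rcal_loc s HR.
  apply: (B_intro HRs) => [|Z AZ]; first by apply: E_coascent; [|apply: B_sub_E].
  apply: ext0_hom_loc; apply: (AB_ext0 HR) => //; exact: A_direct.
move=> R d s X HR s1 X_cta BX; apply: (B_intro HR) => [|Z].
  by apply: (E_codescent HR s1 X_cta) => j; apply: B_sub_E => //; apply: Rcal_loc.
move=> /(A_anti R d s Z HR s1)[F [ZF F_filt]]; apply: ext0_summandl ZF _.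
apply: (filtered_locally_ind (C := fun Y => ext0 Y X)) F_filt.
- by move=> Y Y' f /isom_inv[g [/isom_summand e _ _]]; apply: ext0_summandl.
- by move=> Y; apply: ext0_zero.
- by move=> Y1 Y Y2 f g fg; apply: ext0_extl fg.
- move=> j D AD; apply: ext0_restriction X_cta _.
  exact (AB_ext0 (Rcal_loc (s j) HR) AD (BX j)).
Qed.

(** * Local approximations and filtered envelopes when $\mathsf B$ is very colocal *)

Section VeryColocal.
Hypothesis B_very_colocal : very_colocal Rcal B.
Let B_coascent : coascent Rcal B := B_very_colocal.1.1.
Let B_direct : direct_image Rcal B := B_very_colocal.2.

Section OneRing.
Variables (R : comPzRingType) (HR : Rcal R).
Implicit Types (s : R) (X Y Z V U M : obj k R).

Lemma A_restriction (s : R) (N : obj k (localization s)) : A N -> A (restriction N).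
Proof.
move=> AN; have HRs := Rcal_loc s HR; apply: (A_intro HR) => [|X BX].
  by apply: E_direct HR _; apply: A_sub_E.
apply: ext0_restriction; first exact (E_cta HR (B_sub_E HR BX)).
by apply: (AB_ext0 HRs) => //; apply: B_coascent.
Qed.

(** A test object of [B] over $R[s^{-1}]$ restricts into [B] over $R$, where [G s X], isomorphic to
    [X], is orthogonal to it. *)
Lemma A_hom_loc s X : acts_bij s X -> A X -> A (hom_loc s X).
Proof.
move=> s_bij AX; have HRs := Rcal_loc s HR; apply: (A_intro HRs) => [|W BW].
  by apply: E_coascent => //; apply: A_sub_E.
apply: ext0_reflect; apply: ext0_summandl (isom_summand (counit_isom s_bij)) _.
by apply: (AB_ext0 HR) => //; apply: B_direct.
Qed.

Lemma B_G s X : B X -> B (G s X).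
Proof. by move=> BX; apply: B_direct HR _; apply: B_coascent. Qed.

(** Completeness is applied over $R[s^{-1}]$ and the result restricted, so that the approximation is
    again local. *)
Lemma local_precover s X : E X -> acts_bij s X -> exists V U (f : mor V U) (g : mor U X),
  [/\ B V, A U, acts_bij s U & short_exact f g].
Proof.
move=> EX s_bij; have HRs := Rcal_loc s HR; have [_ compl _] := AB_pair HRs.
have [[V [U [f [g [BV AU [_ _ _ fg]]]]]] _] := compl _ (E_coascent s HR EX).
exists (restriction V), (restriction U), (rmor f), (compm (counit s X) (rmor g)).
split; [exact: B_direct | exact: A_restriction | exact: acts_bij_restriction |].
by apply: short_exact_isomr; [exact: counit_isom | apply/rmor_short_exact].
Qed.

Lemma local_preenvelope s X : E X -> acts_bij s X -> exists V U (f : mor X V) (g : mor V U),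
  [/\ B V, A U, acts_bij s U & short_exact f g].
Proof.
move=> EX s_bij; have HRs := Rcal_loc s HR; have [_ compl _] := AB_pair HRs.
have [_ [V [U [f [g [BV AU [_ _ _ fg]]]]]]] := compl _ (E_coascent s HR EX).
have [j [j_iso _ _]] := isom_inv (counit_isom s_bij).
exists (restriction V), (restriction U), (compm (rmor f) j), (rmor g).
split; [exact: B_direct | exact: A_restriction | exact: acts_bij_restriction |].
by apply: short_exact_isoml => //; apply/rmor_short_exact.
Qed.

Section OneCover.
Variables (d : nat) (s : 'I_d -> R).
Hypothesis s1 : unit_ideal s.
Local Notation filt := (filtered s (@A)).

Lemma filtered_A X : filt X -> A X.
Proof.
elim=> {X} [X X0|X Y j D f g _ AX AD fg]; first exact: A_zero.
exact (A_short_exact HR fg AX (A_restriction AD)).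
Qed.

Lemma filtered_acts_bij j X : A X -> acts_bij (s j) X -> filt X.
Proof.
move=> AX s_bij; apply: (filtered_isom (counit_isom s_bij)).
exact/filtered_local/A_hom_loc.
Qed.

(** A special preenvelope in [B] whose cokernel is filtered by local objects for the given cover. *)
Definition enveloped X := exists V U (f : mor X V) (g : mor V U),
  [/\ B V, filt U & short_exact f g].

(** A horseshoe: the map $(r,a'p)$ into $V\oplus V'$ is mono, with cokernel an extension of $U'$ by
    $U$. The extension [r] of [a] to [Y] is an input, supplied by Ext vanishing or by a
    projection. *)
Lemma enveloped_ext X Y Z V U (i : mor X Y) (p : mor Y Z) (a : mor X V) (b : mor V U)
    (r : mor Y V) :
  short_exact i p -> B V -> filt U -> short_exact a b ->
  (forall n x, ap r n (ap i n x) = ap a n x) -> enveloped Z -> enveloped Y.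
Proof.
move=> ip BV FU ab ri [V' [U' [a' [b' [BV' FU' ab']]]]].
have [W [l1 [q1 [l2 [q2 WP]]]]] := sum2_exists V V'.
have /short_exactP[_ p_surj pi0 pi] := ip.
have /short_exactP[a_inj b_surj ba0 ba] := ab.
have /short_exactP[a'_inj b'_surj ba0' ba'] := ab'.
pose h := addm (compm l1 r) (compm l2 (compm a' p)).
have q1h n y : ap q1 n (ap h n y) = ap r n y.
  by have [q1l1 _ _ q1l2 _] := WP n; rewrite !morE linearD q1l1 q1l2 addr0.
have q2h n y : ap q2 n (ap h n y) = ap a' n (ap p n y).
  by have [_ q2l2 q2l1 _ _] := WP n; rewrite !morE linearD q2l1 q2l2 add0r.
have hi n x : ap h n (ap i n x) = ap l1 n (ap a n x).
  by rewrite !morE pi0 !raddf0 addr0 ri.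
have h_inj : mono h.
  apply: monoP => n y hy; have := q2h n y; rewrite hy raddf0 => /esym/(mono0 a'_inj)/pi[x xy].
  have := q1h n y; rewrite hy raddf0 -xy ri => /esym/(mono0 a_inj)->.
  by rewrite raddf0.
have [Q [c hc]] := cokernel_short_exact h_inj.
have /short_exactP[_ c_surj ch0 ch] := hc.
have [|u uP] := factor_cokernel (h := compm c l1) ab.
  by move=> n x; rewrite compmE -hi ch0.
have [|v vP] := factor_cokernel (h := compm b' q2) hc.
  by move=> n y; rewrite compmE q2h ba0'.
have uv : short_exact u v.
  apply/short_exactP; split=> [|n z|n z|n z].
  - apply: monoP => n z; have [w <-] := b_surj n z; rewrite uP compmE => /ch[y hy].
    have [q1l1 _ q2l1 _ _] := WP n.
    have /(mono0 a'_inj)/pi[x xy] : ap a' n (ap p n y) = 0 by rewrite -q2h hy q2l1.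
    by rewrite -[w]q1l1 -hy -xy q1h ri ba0.
  - have [w <-] := b'_surj n z; exists (ap c n (ap l2 n w)); rewrite vP compmE.
    by have [_ -> _ _ _] := WP n.
  - have [w <-] := b_surj n z; rewrite uP compmE vP compmE.
    by have [_ _ -> _ _] := WP n; rewrite raddf0.
  - have [w <-] := c_surj n z; rewrite vP compmE => /ba'[x xP].
    have [y yx] := p_surj n x; exists (ap b n (ap q1 n w - ap r n y)).
    rewrite uP compmE; apply/eqP; rewrite -subr_eq0 -linearB; apply/eqP.
    have -> : ap l1 n (ap q1 n w - ap r n y) - w = - ap h n y.
      have [_ _ _ _ /(_ w) wE] := WP n.
      rewrite -[w in X in _ - X]wE !morE yx xP linearB opprD addrA opprD.
      by congr (_ + _); rewrite addrAC subrr add0r.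
    by rewrite linearN ch0 oppr0.
exists W, Q, h, c; split=> //; first exact (B_short_exact HR (sum2_short_exact WP) BV BV').
exact: filtered_ext uv FU FU'.
Qed.

Lemma enveloped_acts_bij j X : E X -> acts_bij (s j) X -> enveloped X.
Proof.
move=> EX s_bij; have [V [U [f [g [BV AU U_bij fg]]]]] := local_preenvelope EX s_bij.
by exists V, U, f, g; split=> //; apply: filtered_acts_bij U_bij.
Qed.

Lemma enveloped_zero X : zero_obj X -> enveloped X.
Proof.
move=> X0; exists X, X, (idm X), (idm X); split; [exact: B_zero | exact: filtered_zero |].
apply/short_exactP; split=> [|n x|n x|n x _].
- exact/isom_mono/isom_id.
- by exists x; rewrite idmE.
- exact: X0.
- by exists x; rewrite idmE.
Qed.

Lemma filtered_enveloped X : filt X -> enveloped X.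
Proof.
elim=> {X} [X X0|X Y j D f g FX EX AD fg]; first exact: enveloped_zero.
have [V [U [a [b [BV FU ab]]]]] := EX; have AD' := A_restriction AD.
have [r rP] := ext0_extend a (AB_ext0 HR AD' BV) fg.
apply: enveloped_ext fg BV FU ab rP _.
exact: (enveloped_acts_bij (j := j) (A_sub_E HR AD') (@acts_bij_restriction _ _ _ D)).
Qed.

(** Push [Y] out along the envelope $X\to V$ to get [Q], an extension of the filtered [U] by [Y],
    hence enveloped by some [W]. Then $W/V$ lies in [B] by [B_cokernel], and it contains $Q/V=Z$
    with filtered quotient. *)
Lemma enveloped_cokernel X Y Z (f : mor X Y) (g : mor Y Z) :
  short_exact f g -> E Z -> enveloped X -> enveloped Y -> enveloped Z.
Proof.
move=> fg EZ [V [U [a [b [BV FU ab]]]]] [V1 [U1 [a1 [b1 [BV1 FU1 ab1]]]]].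
have [Q [u [v [g' [_ _ vg desc]]]]] := pushout_short_exact a fg.
have [b' ub] := desc _ _ ab.
have [r rP] := ext0_extend a1 (AB_ext0 HR (filtered_A FU) BV1) ub.
have [W [T [m [q [BW FT mq]]]]] := enveloped_ext ub BV1 FU1 ab1 rP (filtered_enveloped FU).
have [C [p [al [be [bp ab']]]]] := cokernel_comp vg mq.
have EC := E_short_exact HR ab' EZ (A_sub_E HR (filtered_A FT)).
by exists C, T, al, be; split=> //; exact (B_cokernel HR bp BV BW EC).
Qed.

Lemma E_enveloped X : E X -> enveloped X.
Proof.
apply: (local_induction s1 (C := @E R)) => {X} [X|t X|X|j X|].
- exact: E_cta.
- exact: E_G.
- exact: enveloped_zero.
- exact: enveloped_acts_bij.
move=> K X1 X2 S M i1 p1 i2 p2 f e EK E1 E2 EM SP fe vK [V1 [U1 [a1 [b1 [BV1 FU1 ab1]]]]] v2.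
apply: enveloped_cokernel fe EM vK _.
apply: (enveloped_ext (r := compm a1 p1)) (sum2_short_exact SP) BV1 FU1 ab1 _ v2.
by move=> n x; rewrite compmE; have [-> _ _ _ _] := SP n.
Qed.

Lemma A_summand_filtered M : A M -> exists F, summand M F /\ filt F.
Proof.
move=> AM; have EM := A_sub_E HR AM.
have [|||||||N [P [f [g [EN FP fg]]]]] := @local_cover k R d s (@E R) filt s1 _ _ _ _ _ _ _ M EM.
- exact: E_cta.
- by move=> t X; apply: E_G.
- exact: E_zero.
- by move=> X Y Z f g; apply: E_short_exact.
- by move=> X; apply: filtered_zero.
- by move=> X1 X2 S i1 p1 i2 p2 /sum2_short_exact; apply: filtered_ext.
- move=> j X EX s_bij; have [V [U [f [g [BV AU U_bij fg]]]]] := local_precover EX s_bij.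
  exists V, U, f, g; split=> //; first exact: B_sub_E.
  exact: filtered_acts_bij U_bij.
(* The kernel [N] is only in [E]; replacing it by [V] in [B] makes the pushed out extension of [M]
   split. *)
have [V [U [a [b [BV FU ab]]]]] := E_enveloped EN.
have [Q [u [v [g' [_ _ vg desc]]]]] := pushout_short_exact a fg.
have [b' ub] := desc _ _ ab.
have [//|r [t S]] := AB_ext0 HR AM BV (f := v) (g := g').
exists Q; split; last exact: filtered_ext ub FP FU.
by exists V, t, g', v, r; split=> //; apply: sum2_sym.
Qed.

Let local_AB j X := [/\ A X, B X & acts_bij (s j) X].

(** Local precovers of objects of [B] lie in both classes, being extensions inside [B]; the
    resulting cover of [M] has its kernel in [B] and therefore splits. *)
Lemma AB_summand_sum M : A M -> B M -> exists F, summand M F /\ sum_of local_AB F.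
Proof.
move=> AM BM.
have AB0 j X : zero_obj X -> local_AB j X.
  move=> X0; split; [exact: A_zero | exact: B_zero |].
  by apply: acts_bijP => n x => [_|]; [|exists 0]; apply: etrans (X0 n _) (esym (X0 n _)).
have AB_sum j Y1 Y2 S i1 p1 i2 p2 : @direct_sum2 k R Y1 Y2 S i1 p1 i2 p2 ->
    local_AB j Y1 -> local_AB j Y2 -> local_AB j S.
  move=> SP [A1 B1 s_bij1] [A2 B2 s_bij2]; have SE := sum2_short_exact SP.
  split; [exact: A_short_exact SE A1 A2 | exact: B_short_exact SE B1 B2 |].
  apply: acts_bijP => n x.
    move=> sx; have [_ _ _ _ /(_ x)<-] := SP n.
    rewrite (acts_bij_eq0 s_bij1 (m := 1) (x := ap p1 n x)); last by rewrite expr1 -linearZ sx raddf0.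
    rewrite (acts_bij_eq0 s_bij2 (m := 1) (x := ap p2 n x)); last by rewrite expr1 -linearZ sx raddf0.
    by rewrite !raddf0 addr0.
  have [y1 y1P] := acts_bij_div s_bij1 1 (ap p1 n x).
  have [y2 y2P] := acts_bij_div s_bij2 1 (ap p2 n x).
  exists (ap i1 n y1 + ap i2 n y2); have [_ _ _ _ /(_ x) xE] := SP n.
  by rewrite -[RHS]xE -y1P -y2P !expr1 scalerDr !linearZ.
have [|||||||N [P [f [g [BN FP fg]]]]] :=
  @local_cover k R d s (@B R) (sum_of local_AB) s1 _ _ _ _ _ _ _ M BM.
- by move=> X BX; apply: (E_cta HR); apply: B_sub_E.
- by move=> t X; apply: B_G.
- exact: B_zero.
- by move=> X Y Z f g; apply: B_short_exact.
- by move=> X; apply: sum_of_zero.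
- by move=> X1 X2 S i1 p1 i2 p2; apply: sum_of_sum2.
- move=> j X BX s_bij; have [V [U [f [g [BV AU U_bij fg]]]]] := local_precover (B_sub_E HR BX) s_bij.
  exists V, U, f, g; split=> //; apply: (sum_of_local (l := j)) => //; split=> //.
  exact (B_short_exact HR fg BV BX).
have [//|r [t S]] := AB_ext0 HR AM BN (f := f) (g := g).
by exists P; split=> //; exists N, t, g, f, r; split=> //; apply: sum2_sym.
Qed.

Lemma sum_of_local_AB F : sum_of local_AB F ->
  exists D : forall j, obj k (localization (s j)), (forall j, A (D j) /\ B (D j)) /\
    exists i p, direct_sum (D := fun j => restriction (D j)) (X := F) i p.
Proof.
move=> [P [LP [i [p SP]]]]; exists (fun j => hom_loc (s j) (P j)); split=> [j|].
  by have [AP BP s_bij] := LP j; split; [exact: A_hom_loc | exact: B_coascent].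
have c_iso j : isom (counit (s j) (P j)) by have [_ _] := LP j; apply: counit_isom.
have [c cP] := dchoice (fun j => isom_inv (c_iso j)).
exists (fun j => compm (i j) (counit (s j) (P j))), (fun j => compm (c j) (p j)) => n.
have [pi pi0 ip] := SP n; split=> [j x|j l x jl|y].
- by have [_ _ cc] := cP j; rewrite !compmE pi cc.
- by rewrite !compmE pi0 // raddf0.
- rewrite -[RHS]ip; apply: eq_bigr => j _; have [_ cc _] := cP j.
  by rewrite !compmE cc.
Qed.
End OneCover.
End OneRing.

Lemma very_colocal_antilocal : antilocal Rcal A.
Proof.
move=> R d s X HR s1; split=> [AX|[F [XF F_filt]]].
  have [F [XF FF]] := A_summand_filtered HR s1 AX.
  by exists F; split=> //; apply: filtered_filtered_locally.
apply: (A_of_summand HR XF); apply: (filtered_locally_ind (C := @A R)) F_filt.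
- by move=> Y Y' f; apply: A_isom.
- exact: A_zero.
- by move=> Y1 Y Y2 f g; apply: A_short_exact.
- by move=> j D; apply: A_restriction.
Qed.

Lemma very_colocal_strongly_antilocal :
  strongly_antilocal Rcal (fun R X => @A R X /\ @B R X).
Proof.
move=> R d s X HR s1; split=> [[AX BX]|[D [AD [F [i [p [XF SP]]]]]]].
  have [F [XF /(sum_of_local_AB HR)[D [AD [i [p SP]]]]]] := AB_summand_sum HR s1 AX BX.
  by exists D; split=> //; exists F, i, p.
split.
  apply: (A_of_summand HR XF).
  apply: (sum_of_closed (C := @A R)) SP => [Y|Y1 Y Y2 f g|j].
  - exact: A_zero.
  - exact: A_short_exact.
  - by apply: A_restriction => //; case: (AD j).
apply: (B_of_summand HR XF).
apply: (sum_of_closed (C := @B R)) SP => [Y|Y1 Y Y2 f g|j].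
- exact: B_zero.
- exact: B_short_exact.
- by apply: B_direct => //; case: (AD j).
Qed.
End VeryColocal.
End CotorsionSystem.

Theorem theorem5p1 (k : ambient) (Rcal : comPzRingType -> Prop)
  (Rcal_loc : forall (R : comPzRingType) (s : R), Rcal R -> Rcal (localization s))
  (E A B : class_system k)
  (E_iso : forall R, Rcal R -> iso_closed (E R))
  (A_iso : forall R, Rcal R -> iso_closed (A R))
  (B_iso : forall R, Rcal R -> iso_closed (B R))
  (E_cta : forall R, Rcal R -> forall X, E R X -> cta X)
  (E_ext : forall R, Rcal R -> ext_closed_in cta (E R))
  (E_summand : forall R, Rcal R -> summand_closed_in cta (E R))
  (E_very_colocal : very_colocal Rcal E)
  (A_sub_E : forall R, Rcal R -> forall X, A R X -> E R X)
  (B_sub_E : forall R, Rcal R -> forall X, B R X -> E R X)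
  (AB_pair : forall R, Rcal R ->
     hereditary_complete_cotorsion_pair (E R) (A R) (B R)) :
  [/\ antilocal Rcal A -> colocal Rcal B,
      very_colocal Rcal B -> antilocal Rcal A
    & very_colocal Rcal B ->
      strongly_antilocal Rcal (fun R X => A R X /\ B R X)].
Proof.
split.
- exact: (antilocal_colocal Rcal_loc E_cta E_ext E_very_colocal A_sub_E B_sub_E AB_pair).
- exact: (very_colocal_antilocal Rcal_loc E_iso E_cta E_ext E_summand E_very_colocal
    A_sub_E B_sub_E AB_pair).
- exact: (very_colocal_strongly_antilocal Rcal_loc E_iso E_cta E_ext E_summand
    E_very_colocal A_sub_E B_sub_E AB_pair).
Qed.
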